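(* Let $L$ be an $n$-dimensional nilpotent Lie algebra with $\dim L^2=m$, where $m\geq 1$. Then \[\dim \mathcal{M}^{(2)}(L)\leq \tfrac13(n-m)\big((n+2m-2)(n-m-1)+3(m-1)\big)+3.\] In particular, $\dim\mathcal{M}^{(2)}(L)\leq \frac13 n(n-1)(n-2)+3$, and equality holds in this last inequality if and only if $L\cong H(1)\oplus A(n-3)$.
   Context: All Lie algebras are over a fixed field. For a Lie algebra $L$ with free presentation $L\cong F/R$, the $2$-nilpotent multiplier is $\mathcal{M}^{(2)}(L)=(R\cap F^{3})/[[R,F],F]$, where $F^3=[[F,F],F]$. $A(k)$ denotes the abelian Lie algebra of dimension $k$, and $H(1)$ is the $3$-dimensional Heisenberg Lie algebra (dimension $3$, $H(1)^2=Z(H(1))$, $\dim H(1)^2=1$). *)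

(* Defs.v *)
From HB Require Import structures.
From mathcomp Require Import all_boot all_order all_algebra.
From mathcomp Require Import ring.

Set Implicit Arguments.
Unset Strict Implicit.
Unset Printing Implicit Defensive.

Import GRing.Theory.
Local Open Scope ring_scope.

HB.mixin Record isLieAlgebra (K : fieldType) (V : Type) of GRing.Lmodule K V := {
  lbr : V -> V -> V;
  lbr_linl : forall (a : K) (x y z : V), lbr (a *: x + y) z = a *: lbr x z + lbr y z;
  lbr_linr : forall (a : K) (x y z : V), lbr z (a *: x + y) = a *: lbr z x + lbr z y;
  lbr_alt : forall x : V, lbr x x = 0;
  lbr_jacobi : forall x y z : V,
      lbr x (lbr y z) + lbr y (lbr z x) + lbr z (lbr x y) = 0
}.

#[short(type="lieAlgType")]
HB.structure Definition LieAlgebra (K : fieldType) :=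
  { V of isLieAlgebra K V & GRing.Lmodule K V }.

Section LieDefs.
Variable K : fieldType.

(* Subspaces of an arbitrary K-module are represented as predicates. *)
Definition allv (V : lmodType K) : V -> Prop := fun _ => True.

Definition lspan (V : lmodType K) (S : V -> Prop) : V -> Prop :=
  fun x => exists (k : nat) (c : 'I_k -> K) (v : 'I_k -> V),
      (forall i, S (v i)) /\ x = \sum_(i < k) c i *: v i.

Definition lbrs (L : lieAlgType K) (A B : L -> Prop) : L -> Prop :=
  lspan (fun x => exists a b, A a /\ B b /\ x = lbr a b).

(* Lower central series: lie_pow L 1 = L, lie_pow L (k+1) = [L^k, L]
   (so lie_pow L 2 = L^2 = [L,L] and lie_pow L 3 = L^3 = [[L,L],L]);
   by convention lie_pow L 0 = L as well. *)
Fixpoint lie_pow (L : lieAlgType K) (k : nat) : L -> Prop :=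
  match k with
  | 0 | 1 => @allv L
  | k'.+1 => lbrs (@lie_pow L k') (@allv L)
  end.
Arguments lie_pow L k _ : clear implicits.

Definition nilpotent (L : lieAlgType K) : Prop :=
  exists c : nat, forall x : L, lie_pow L c x -> x = 0.

(* dim (V / W) = d, for subspaces W <= V of a K-module:
   there are d vectors of V, linearly independent modulo W,
   spanning V modulo W. *)
Definition qdim (M : lmodType K) (V W : M -> Prop) (d : nat) : Prop :=
  exists v : 'I_d -> M,
    (forall i, V (v i)) /\
    (forall c : 'I_d -> K, W (\sum_(i < d) c i *: v i) -> forall i, c i = 0) /\
    (forall x, V x -> exists c : 'I_d -> K, W (x - \sum_(i < d) c i *: v i)).

Definition sdim (M : lmodType K) (V : M -> Prop) (d : nat) : Prop :=
  qdim V (fun x => x = 0) d.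

Definition lie_hom (L M : lieAlgType K) (f : L -> M) : Prop :=
  (forall (a : K) (x y : L), f (a *: x + y) = a *: f x + f y) /\
  (forall x y : L, f (lbr x y) = lbr (f x) (f y)).

Definition lie_isomorphic (L M : lieAlgType K) : Prop :=
  exists f : L -> M, lie_hom f /\ bijective f.

Definition free_on (X : Type) (F : lieAlgType K) (iX : X -> F) : Prop :=
  forall (M : lieAlgType K) (f : X -> M),
    exists g : F -> M,
      [/\ lie_hom g, (forall x, g (iX x) = f x) &
          forall g' : F -> M, lie_hom g' -> (forall x, g' (iX x) = f x) ->
            forall y, g' y = g y].

(* For a free presentation pi : F ->> L with kernel R:
   numerator   R /\ F^3  and denominator [[R,F],F] of the 2-nilpotent
   multiplier M^(2)(L) = (R /\ F^3) / [[R,F],F]. *)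
Definition ker_of (F L : lieAlgType K) (pi : F -> L) : F -> Prop :=
  fun x => pi x = 0.

Definition mult2_num (F L : lieAlgType K) (pi : F -> L) : F -> Prop :=
  fun x => ker_of pi x /\ lie_pow F 3 x.

Definition mult2_den (F L : lieAlgType K) (pi : F -> L) : F -> Prop :=
  lbrs (lbrs (ker_of pi) (@allv F)) (@allv F).

End LieDefs.
Arguments lie_pow {K} L k _.

(* The concrete Lie algebra H(1) (+) A(k), of dimension k+3:           *)
(* on row vectors of length k+3 with basis e_0, e_1, e_2, ...,         *)
(* the only nonzero bracket of basis vectors is [e_0, e_1] = e_2.      *)
Section HA.
Variables (K : fieldType) (k : nat).

Definition HA_type := 'rV[K]_(k.+3).
HB.instance Definition _ := GRing.Lmodule.on HA_type.

Let i0 : 'I_(k.+3) := inord 0.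
Let i1 : 'I_(k.+3) := inord 1.
Let i2 : 'I_(k.+3) := inord 2.
Let e2 : HA_type := \row_j (j == i2)%:R.

Definition HA_br (u v : HA_type) : HA_type :=
  (u 0 i0 * v 0 i1 - u 0 i1 * v 0 i0) *: e2.

Let ne02 : (i0 == i2) = false.
Proof. by apply/eqP => /(congr1 val); rewrite /= !inordK. Qed.
Let ne12 : (i1 == i2) = false.
Proof. by apply/eqP => /(congr1 val); rewrite /= !inordK. Qed.

Lemma HA_linl (a : K) (x y z : HA_type) :
  HA_br (a *: x + y) z = a *: HA_br x z + HA_br y z.
Proof.
rewrite /HA_br !mxE scalerA -scalerDl; congr (_ *: _); ring.
Qed.

Lemma HA_linr (a : K) (x y z : HA_type) :
  HA_br z (a *: x + y) = a *: HA_br z x + HA_br z y.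
Proof.
rewrite /HA_br !mxE scalerA -scalerDl; congr (_ *: _); ring.
Qed.

Lemma HA_alt (x : HA_type) : HA_br x x = 0.
Proof. by rewrite /HA_br mulrC subrr scale0r. Qed.

Lemma HA_br_e2 (x y z : HA_type) : HA_br x (HA_br y z) = 0.
Proof. by rewrite /HA_br /e2 !mxE ne02 ne12 !mulr0 subrr scale0r. Qed.

Lemma HA_jacobi (x y z : HA_type) :
  HA_br x (HA_br y z) + HA_br y (HA_br z x) + HA_br z (HA_br x y) = 0.
Proof. by rewrite !HA_br_e2 !addr0. Qed.

HB.instance Definition _ :=
  isLieAlgebra.Build K HA_type HA_linl HA_linr HA_alt HA_jacobi.

End HA.

Definition HA (K : fieldType) (k : nat) : lieAlgType K := HA_type K k.

(* Main.v *)
Require Import Defs.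
From HB Require Import structures.
From mathcomp Require Import all_boot all_order all_algebra.
From mathcomp Require Import zify ring lra.
From Stdlib Require Import Classical.

(** Let [L = F/R], [d = n - m], [W = [[R,F],F]].  If [z] in [F^2] is central modulo [R]
    and [S = R + <z>], then [[S,F],F] is spanned modulo [W] by the [d^2] elements
    [[z, f i], f j]; by induction on [m] this reduces the upper bound to [m = 1].
    There [F^2 <= R + <z>] with [z = [p,q]], and [F^3] is spanned modulo [W] by the
    [(d^3 - d)/3] basic commutators and the elements [[z,x],y], which are symmetric in
    [x, y] and, by Jacobi, reduce to [x, y] in [{p, q}]: three more.  If two elements
    commuting with [p] and [q] modulo [R] do not commute with each other, these three
    vanish as well; otherwise [L] is [H(1) + A(n-3)].

    Conversely, for [H(1) + A(k)] the spanning family is independent modulo [W]: freeness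
    of [F] yields homomorphisms to the metabelian algebras [K |x K[X]/X^r], and the top
    coefficients of these kill [W] but separate the family. *)

Set Implicit Arguments.
Unset Strict Implicit.
Unset Printing Implicit Defensive.

Import Order.TTheory GRing.Theory Num.Theory.
Local Open Scope ring_scope.

(** * Linear algebra modulo a subspace given as a predicate: spanning, independence, dimension *)

Section Subspaces.
Variables (K : fieldType) (M : lmodType K).
Implicit Types (V W S : M -> Prop).

Definition subspace W := W 0 /\ forall (a : K) x y, W x -> W y -> W (a *: x + y).

Lemma subspace0 W : subspace W -> W 0. Proof. by case. Qed.

Lemma subspaceZ W a x : subspace W -> W x -> W (a *: x).
Proof. by case=> W0 WD Wx; rewrite -[_ *: _]addr0; exact: WD. Qed.

Lemma subspaceD W x y : subspace W -> W x -> W y -> W (x + y).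
Proof. by case=> W0 WD Wx Wy; rewrite -[x]scale1r; exact: WD. Qed.

Lemma subspaceN W x : subspace W -> W x -> W (- x).
Proof. by move=> sW Wx; rewrite -scaleN1r; exact: subspaceZ. Qed.

Lemma subspaceB W x y : subspace W -> W x -> W y -> W (x - y).
Proof. by move=> sW Wx Wy; apply: subspaceD => //; apply: subspaceN. Qed.

Lemma subspace_sum W (I : Type) (r : seq I) (P : pred I) (f : I -> M) :
  subspace W -> (forall i, P i -> W (f i)) -> W (\sum_(i <- r | P i) f i).
Proof.
move=> sW Wf; elim/big_ind: _ => //; first exact: subspace0.
by move=> x y; apply: subspaceD.
Qed.

Lemma subspace_eq0 : subspace (fun x : M => x = 0).
Proof. by split=> // a x y -> ->; rewrite scaler0 addr0. Qed.

Lemma subspace_scaleK W a x : subspace W -> a != 0 -> W (a *: x) -> W x.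
Proof.
by move=> sW a0 Wax; rewrite -[x]scale1r -(mulVf a0) -scalerA; apply: subspaceZ.
Qed.

Lemma lspan_subspace S : subspace (lspan S).
Proof.
split.
  exists 0%N, (fun _ => 0), (fun _ => 0); split; first by case.
  by rewrite big_ord0.
move=> a x y [k [c [v [Sv ->]]]] [l [d [w [Sw ->]]]].
exists (k + l)%N, (fun i => match split i with inl j => a * c j | inr j => d j end),
  (fun i => match split i with inl j => v j | inr j => w j end).
split; first by move=> i; case: (split i).
rewrite big_split_ord /= scaler_sumr; congr (_ + _); apply: eq_bigr => i _.
  by rewrite (unsplitK (inl i)) scalerA.
by rewrite (unsplitK (inr i)).
Qed.

Lemma mem_lspan S x : S x -> lspan S x.
Proof.
move=> Sx; exists 1%N, (fun _ => 1), (fun _ => x); split=> //.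
by rewrite big_ord1 scale1r.
Qed.

Lemma lspan_min S W : subspace W -> (forall x, S x -> W x) -> forall x, lspan S x -> W x.
Proof.
move=> sW SW x [k [c [v [Sv ->]]]]; apply: subspace_sum => // i _.
by apply: subspaceZ => //; apply: SW.
Qed.

(** The index may be any finite type, so that families can be glued along [I + J]. *)
Definition span_mod W (I : finType) (v : I -> M) (x : M) :=
  exists c : I -> K, W (x - \sum_i c i *: v i).

Lemma span_mod_subspace W (I : finType) (v : I -> M) :
  subspace W -> subspace (span_mod W v).
Proof.
move=> sW; split.
  exists (fun _ => 0); rewrite big1 ?subr0; last by move=> i _; rewrite scale0r.
  exact: subspace0.
move=> a x y [c Wc] [d Wd]; exists (fun i => a * c i + d i).
have -> : \sum_i (a * c i + d i) *: v i = a *: \sum_i c i *: v i + \sum_i d i *: v i.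
  rewrite scaler_sumr -big_split; apply: eq_bigr => i _.
  by rewrite scalerDl scalerA.
rewrite opprD addrACA -scalerBr; apply: subspaceD => //; exact: subspaceZ.
Qed.

Lemma span_mod_sub W (I : finType) (v : I -> M) x : W x -> span_mod W v x.
Proof.
move=> Wx; exists (fun _ => 0); rewrite big1 ?subr0 // => i _.
by rewrite scale0r.
Qed.

Lemma span_mod_mem W (I : finType) (v : I -> M) i : subspace W -> span_mod W v (v i).
Proof.
move=> sW; exists (fun j => (j == i)%:R); rewrite (bigD1 i) //= eqxx scale1r.
rewrite big1 ?addr0 ?subrr; first exact: subspace0.
by move=> j /negPf->; rewrite scale0r.
Qed.

Lemma span_mod_trans W W' (I J : finType) (v : I -> M) (w : J -> M) x :
  (forall y, W y -> span_mod W' w y) -> span_mod W v x ->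
  span_mod W' (fun s : I + J => match s with inl i => v i | inr j => w j end) x.
Proof.
move=> WW' [c /WW'[d Wd]].
exists (fun s => match s with inl i => c i | inr j => d j end).
by rewrite big_sumType /= opprD addrA.
Qed.

Lemma span_mod_ord W (I : finType) (v : I -> M) x :
  span_mod W v x -> span_mod W (fun i : 'I_#|I| => v (enum_val i)) x.
Proof.
move=> [c Wc]; exists (fun i => c (enum_val i)).
by move: Wc; rewrite (reindex _ (onW_bij _ (@enum_val_bij I))).
Qed.

Definition indep_mod W (I : finType) (v : I -> M) :=
  forall c : I -> K, W (\sum_i c i *: v i) -> forall i, c i = 0.

Lemma indep_mod_ord W (I : finType) (v : I -> M) :
  indep_mod W v -> indep_mod W (fun i : 'I_#|I| => v (enum_val i)).
Proof.
move=> iv c Wc i.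
have /(iv (fun x => c (enum_rank x))) /(_ (enum_val i)) : W (\sum_x c (enum_rank x) *: v x).
  rewrite (reindex _ (onW_bij _ (@enum_val_bij I))) /=.
  by under eq_bigr do rewrite enum_valK.
by rewrite enum_valK.
Qed.

(** If [N < k], the [k] by [N] matrix of coefficients has a nonzero row [u] in its left kernel, and
    [u] is a nontrivial relation among the [w i] modulo [W]. *)
Lemma steinitz W k N (w : 'I_k -> M) (v : 'I_N -> M) :
  subspace W -> indep_mod W w -> (forall i, span_mod W v (w i)) -> (k <= N)%N.
Proof.
move=> sW iw /(@fin_all_exists _ _ _)[c Wc].
rewrite leqNgt; apply/negP => ltNk.
pose A := \matrix_(i < k, j < N) c i j.
have : kermx A != 0.
  by rewrite kermx_eq0 /row_free neq_ltn (leq_ltn_trans (rank_leq_col A)).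
case/rowV0Pn=> u /sub_kermxP uA0 /eqP; apply; apply/rowP => i; rewrite mxE.
apply: (iw (fun i => u 0 i)) => {i}.
have -> : \sum_i u 0 i *: w i = \sum_i u 0 i *: (w i - \sum_j c i j *: v j).
  under [RHS]eq_bigr do rewrite scalerBr scaler_sumr.
  rewrite sumrB exchange_big /= [X in _ - X]big1 ?subr0 // => j _.
  under eq_bigr do rewrite scalerA.
  rewrite -scaler_suml; have /matrixP/(_ 0 j) := uA0; rewrite !mxE.
  by under eq_bigr do rewrite mxE; move->; rewrite scale0r.
by apply: subspace_sum => // i _; apply: subspaceZ.
Qed.

Lemma qdim_le V W d (I : finType) (v : I -> M) :
  subspace W -> qdim V W d -> (forall x, V x -> span_mod W v x) -> (d <= #|I|)%N.
Proof.
move=> sW [w [Vw [iw _]]] Vv.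
apply: (steinitz (v := fun i => v (enum_val i)) sW iw) => i.
by apply: span_mod_ord; apply: Vv.
Qed.

Lemma qdim_ge V W d (I : finType) (v : I -> M) :
  subspace W -> qdim V W d -> (forall i, V (v i)) -> indep_mod W v -> (#|I| <= d)%N.
Proof.
move=> sW [w [_ [_ gw]]] Vv /indep_mod_ord iv.
by apply: (steinitz sW iv) => i; apply: gw.
Qed.

Lemma indep_mod_extend W k (w : 'I_k -> M) x :
  subspace W -> indep_mod W w -> ~ span_mod W w x ->
  indep_mod W (fun i : 'I_k.+1 => oapp w x (unlift ord_max i)).
Proof.
move=> sW iw nwx c; rewrite (bigD1_ord ord_max) //= unlift_none /=.
under eq_bigr do rewrite liftK /=.
move=> Wc; have cm : c ord_max = 0.
  apply/eqP/negP => /negP cm; apply: nwx.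
  exists (fun i => - (c ord_max)^-1 * c (lift ord_max i)).
  apply: (subspace_scaleK sW cm); rewrite scalerBr scaler_sumr -sumrN.
  move: Wc; congr (W (_ + _)); apply: eq_bigr => i _.
  by rewrite scalerA mulrA mulrN divff // mulN1r scaleNr opprK.
move=> i; case: (unliftP ord_max i) => [i' ->|->//].
apply: (iw (fun i => c (lift ord_max i))).
by move: Wc; rewrite cm scale0r add0r.
Qed.

Lemma qdim_ex V W (I : finType) (v : I -> M) :
  subspace W -> (forall x, V x -> span_mod W v x) -> exists d, qdim V W d.
Proof.
move=> sW Vv.
(* Greedy extension: the [k] vectors found so far are independent modulo [W], so [steinitz] bounds
   [k] by [#|I|]; [j] measures the room that is left. *)
suff H : forall j k (w : 'I_k -> M), (#|I| < k + j)%N -> (forall i, V (w i)) ->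
    indep_mod W w -> exists d, qdim V W d.
  apply: (H #|I|.+1 0%N (fun _ => 0)) => //; first by case.
  by move=> c _; case.
elim=> [|j IH] k w ltk Vw iw.
  have : (k <= #|I|)%N.
    apply: (steinitz (v := fun i => v (enum_val i)) sW iw) => i.
    by apply: span_mod_ord; apply: Vv.
  by rewrite leqNgt -(addn0 k) ltk.
case: (classic (forall x, V x -> span_mod W w x)) => gw; first by exists k, w.
have [x nx] := not_all_ex_not _ _ gw; have [Vx nwx] := imply_to_and _ _ nx.
apply: (IH _ _ _ _ (indep_mod_extend sW iw nwx)).
  by rewrite addSn -addnS.
by move=> i; case: (unlift _ _).
Qed.

Lemma qdim_unique V W k l : subspace W -> qdim V W k -> qdim V W l -> k = l.
Proof.
move=> sW; have le a b : qdim V W a -> qdim V W b -> (a <= b)%N.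
  move=> qa [w [Vw [iw gw]]]; rewrite -[b]card_ord.
  exact: (qdim_le sW qa gw).
by move=> qk ql; apply/eqP; rewrite eqn_leq !le.
Qed.

Lemma qdim_add A B C k l : subspace A -> subspace B -> subspace C ->
  (forall x, B x -> A x) -> (forall x, C x -> B x) ->
  qdim A B k -> qdim B C l -> qdim A C (k + l).
Proof.
move=> sA sB sC BA CB [v [Av [iv gv]]] [w [Bw [iw gw]]].
exists (fun i => match split i with inl j => v j | inr j => w j end).
have E (c : 'I_(k + l) -> K) : \sum_i c i *: (match split i with inl j => v j | inr j => w j end)
    = \sum_i c (lshift l i) *: v i + \sum_i c (rshift k i) *: w i.
  rewrite big_split_ord; congr (_ + _); apply: eq_bigr => i _.
    by rewrite (unsplitK (inl i)).
  by rewrite (unsplitK (inr i)).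
split; first by move=> i; case: (split i) => j //; apply: BA.
split=> [c|x Ax].
  rewrite E => Cc.
  have c1 : forall i, c (lshift l i) = 0.
    apply: iv; have Bs : B (\sum_i c (rshift k i) *: w i).
      by apply: subspace_sum => // i _; apply: subspaceZ.
    by rewrite -[X in B X](addrK (\sum_i c (rshift k i) *: w i)); apply: subspaceB => //; apply: CB.
  have c2 : forall i, c (rshift k i) = 0.
    apply: iw; move: Cc; rewrite big1 ?add0r // => i _.
    by rewrite c1 scale0r.
  by move=> i; rewrite -(splitK i); case: (split i).
have [c Bc] := gv x Ax; have [e Ce] := gw _ Bc.
exists (fun i => match split i with inl j => c j | inr j => e j end).
rewrite E opprD addrA; move: Ce; congr (C (x - _ - _)); apply: eq_bigr => i _.
  by rewrite (unsplitK (inl i)).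
by rewrite (unsplitK (inr i)).
Qed.

(** Since [z] is not in [W], some [v i] has a nonzero coefficient in [z] and can be traded for it.
    Modulo [W + <z>] one spanning vector fewer is needed; this drives the induction on the dimension
    of [L^2]. *)
Lemma span_mod_exchange V W k (v : 'I_k.+1 -> M) z : subspace W ->
  (forall x, V x -> span_mod W v x) -> V z -> ~ W z ->
  exists w : 'I_k -> M, forall x, V x -> span_mod (fun y => exists a, W (y - a *: z)) w x.
Proof.
move=> sW Vv Vz nWz; have [c Wc] := Vv z Vz.
have [i ci] : exists i, c i != 0.
  apply: NNPP => nc; apply: nWz; move: Wc; rewrite big1 ?subr0 // => i _.
  have /eqP -> : c i == 0 by apply/negP => /negP ci; apply: nc; exists i.
  by rewrite scale0r.
exists (fun j => v (lift i j)) => x /Vv[e We].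
(* Subtracting [e i / c i] times the relation for [z] removes [v i] from the expansion of [x] and
   leaves the term [(e i / c i) *: z]. *)
exists (fun j => e (lift i j) - e i / c i * c (lift i j)), (e i / c i).
move: Wc We; rewrite !(bigD1_ord i) //= => Wc We.
have := subspaceB sW We (subspaceZ (e i / c i) sW Wc); congr W.
rewrite scalerBr scalerDr scalerA divfK // !opprB.
have -> : \sum_j (e (lift i j) - e i / c i * c (lift i j)) *: v (lift i j) =
  \sum_j e (lift i j) *: v (lift i j) - (e i / c i) *: \sum_j c (lift i j) *: v (lift i j).
  rewrite scaler_sumr -sumrB; apply: eq_bigr => j _; by rewrite scalerBl scalerA.
set P := \sum_j _; set Q := _ *: \sum_j _; set R := e i *: _; set T := _ *: z.
by rewrite !(opprD, opprB, opprK) ?addrA [x - R - P]addrAC subrK.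
Qed.

End Subspaces.

(** * Bracket identities, ideals and the lower central series *)

Section LieTheory.
Variables (K : fieldType) (L : lieAlgType K).
Implicit Types (x y z : L) (R U : L -> Prop).

Lemma lbrDl x y z : lbr (x + y) z = lbr x z + lbr y z.
Proof. by rewrite -{1}[x]scale1r lbr_linl scale1r. Qed.
Lemma lbrDr x y z : lbr z (x + y) = lbr z x + lbr z y.
Proof. by rewrite -{1}[x]scale1r lbr_linr scale1r. Qed.
Lemma lbr0l z : lbr 0 z = 0.
Proof. by apply: (addrI (lbr 0 z)); rewrite -lbrDl !addr0. Qed.
Lemma lbr0r z : lbr z 0 = 0.
Proof. by apply: (addrI (lbr z 0)); rewrite -lbrDr !addr0. Qed.
Lemma lbrZl a x z : lbr (a *: x) z = a *: lbr x z.
Proof. by rewrite -[a *: x]addr0 lbr_linl lbr0l addr0. Qed.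
Lemma lbrZr a x z : lbr z (a *: x) = a *: lbr z x.
Proof. by rewrite -[a *: x]addr0 lbr_linr lbr0r addr0. Qed.
Lemma lbrNl x z : lbr (- x) z = - lbr x z.
Proof. by rewrite -!scaleN1r lbrZl. Qed.
Lemma lbrBl x y z : lbr (x - y) z = lbr x z - lbr y z.
Proof. by rewrite lbrDl lbrNl. Qed.

Lemma lbrC x y : lbr x y = - lbr y x.
Proof.
apply/eqP; rewrite -addr_eq0; have := lbr_alt (x + y).
by rewrite lbrDl !lbrDr !lbr_alt add0r addr0 => ->.
Qed.

(** Jacobi for left-normed brackets: bracketing with [z] is a derivation. *)
Lemma lbr_lbr x y z : lbr (lbr x y) z = lbr (lbr x z) y - lbr (lbr y z) x.
Proof.
have := lbr_jacobi z x y.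
rewrite (lbrC z (lbr x y)) (lbrC x (lbr y z)) (lbrC y (lbr z x)) (lbrC z x) lbrNl opprK => J.
apply/eqP; rewrite -subr_eq0 -oppr_eq0 !(opprD, opprB, opprK) -J.
by apply/eqP; rewrite [RHS]addrC addrA [RHS]addrAC.
Qed.

Definition ideal R := subspace R /\ forall x y, R x -> R (lbr x y).

Lemma lbrs_subspace R U : subspace (lbrs R U).
Proof. exact: lspan_subspace. Qed.

Lemma mem_lbrs R U x y : R x -> U y -> lbrs R U (lbr x y).
Proof. by move=> Rx Uy; apply: mem_lspan; exists x, y. Qed.

Lemma lbrs_min R U P : subspace P -> (forall x y, R x -> U y -> P (lbr x y)) ->
  forall x, lbrs R U x -> P x.
Proof. by move=> sP RUP; apply: lspan_min => // _ [x [y [Rx [Uy ->]]]]; apply: RUP. Qed.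

Lemma lie_pow_subspace k : subspace (lie_pow L k).
Proof. by case: k => [|[|k]] //; apply: lbrs_subspace. Qed.

Lemma lie_pow2 x y : lie_pow L 2 (lbr x y). Proof. exact: mem_lbrs. Qed.

Lemma lie_powS k x y : lie_pow L k x -> lie_pow L k.+1 (lbr x y).
Proof. by case: k => [//|k] Lx; apply: mem_lbrs. Qed.

Lemma lie_pow_anti k x : lie_pow L k.+1 x -> lie_pow L k x.
Proof.
elim: k x => [|[|k] IH] // x.
apply: lbrs_min; first exact: lbrs_subspace.
by move=> y z Ly _; apply: mem_lbrs => //; apply: IH.
Qed.

Lemma lie_pow_sub2 k x : lie_pow L k.+2 x -> lie_pow L 2 x.
Proof. by elim: k x => [|k IH] // x /lie_pow_anti /IH. Qed.

Lemma subspace_lbrl U y : subspace U -> subspace (fun x => U (lbr x y)).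
Proof.
move=> sU; split; first by rewrite lbr0l; apply: subspace0.
by move=> a x x' Ux Ux'; rewrite lbr_linl; case: sU => _; apply.
Qed.

Lemma subspace_lbrr U y : subspace U -> subspace (fun x => U (lbr y x)).
Proof.
move=> sU; split; first by rewrite lbr0r; apply: subspace0.
by move=> a x x' Ux Ux'; rewrite lbr_linr; case: sU => _; apply.
Qed.

(** * Computation modulo [[[R,F],F]], and the passage from [R] to [R + <z>]; the ambient algebra [L]
    plays the part of [F] *)

Section Multiplier.
Variable R : L -> Prop.
Hypothesis idR : ideal R.
Let sR : subspace R. Proof. by case: idR. Qed.

(* Convertible to [mult2_den pi] when [R] is [ker_of pi]. *)
Definition den := lbrs (lbrs R (@allv K L)) (@allv K L).

Lemma den_subspace : subspace den. Proof. exact: lbrs_subspace. Qed.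
Local Hint Resolve den_subspace : core.

Lemma den1 r x y : R r -> den (lbr (lbr r x) y).
Proof. by move=> Rr; apply: mem_lbrs => //; apply: mem_lbrs. Qed.

Lemma den2 r x y : R r -> den (lbr (lbr x r) y).
Proof. by move=> Rr; rewrite (lbrC x) lbrNl; apply: subspaceN => //; apply: den1. Qed.

Lemma den3 r x y : R r -> den (lbr (lbr x y) r).
Proof.
by move=> Rr; rewrite lbr_lbr; apply: subspaceB => //; apply: den2.
Qed.

(** [F^2] is spanned by brackets, and [den3] puts the bracket of each with an element of [R] into
    [den]; thus [[R,F^2]] lies in [[[R,F],F]]. *)
Lemma den_pow2r r y : R r -> lie_pow L 2 y -> den (lbr r y).
Proof.
move=> Rr; apply: (lbrs_min (subspace_lbrr r den_subspace)) => x z _ _.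
by rewrite lbrC; apply: subspaceN => //; apply: den3.
Qed.

Variables (d : nat) (f : 'I_d -> L) (z : L).
Hypothesis z2 : lie_pow L 2 z.
Hypothesis zR : forall x, R (lbr z x).

(** The ideal [S = R + <z>], written so as to be convertible with the modulus that
    [span_mod_exchange] produces. *)
Definition addR (x : L) := exists a : K, R (x - a *: z).

Lemma R_addR x : R x -> addR x.
Proof. by move=> Rx; exists 0; rewrite scale0r subr0. Qed.

Lemma addR_subspace : subspace addR.
Proof.
split; first by apply: R_addR; apply: subspace0.
move=> a x y [b Rb] [c Rc]; exists (a * b + c).
rewrite scalerDl -scalerA opprD addrACA -scalerBr.
by apply: subspaceD => //; apply: subspaceZ.
Qed.

Lemma addR_ideal : ideal addR.
Proof.
split=> [|x y [a Ra]]; first exact: addR_subspace.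
apply: R_addR; rewrite -[x](subrK (a *: z)) lbrDl lbrZl.
by apply: subspaceD => //; [case: idR => _; apply | apply: subspaceZ].
Qed.

(** Writing [[x,w] = a z + r], the first term commutes with [z] and the second falls under
    [den_pow2r]. *)
Lemma den_z x w : addR (lbr x w) -> den (lbr (lbr x w) z).
Proof.
case=> a Ra; rewrite -[lbr x w](subrK (a *: z)) lbrDl lbrZl lbr_alt scaler0 addr0.
exact: den_pow2r.
Qed.

(** By Jacobi the difference is [[[x,y],z]] up to sign. So [[[z,x],y]] is symmetric modulo [den]
    wherever [[x,y]] lies in [R + <z>]. *)
Lemma den_z_sym x y : addR (lbr x y) -> den (lbr (lbr z x) y - lbr (lbr z y) x).
Proof.
move=> Rxy; have -> : lbr (lbr z x) y - lbr (lbr z y) x = - lbr (lbr x y) z.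
  by rewrite (lbr_lbr x y z) (lbrC x z) (lbrC y z) !lbrNl opprB opprK addrC.
by apply: subspaceN => //; apply: den_z.
Qed.

(** Holding for all [x], this says that the images of the [f i] span the abelianization of the
    quotient by [R]. *)
Definition fgens := lspan (fun x => [\/ exists i, x = f i, lie_pow L 2 x | R x]).

(** The [R] part of [S] contributes only to [den], which leaves the elements [[[z,x],y]]. These lie
    in [den] as soon as [x] or [y] is in [R] or in [F^2], so both may be taken among the [f i]. *)
Lemma den_addR : (forall x, fgens x) -> forall x, lbrs (lbrs addR (@allv K L)) (@allv K L) x ->
  span_mod den (fun ij : 'I_d * 'I_d => lbr (lbr z (f ij.1)) (f ij.2)) x.
Proof.
move=> gf; set U := span_mod _ _.
have sU : subspace U by apply: span_mod_subspace.
have Uden : forall x, den x -> U x by move=> x; apply: span_mod_sub.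
suff zU x y : U (lbr (lbr z x) y).
  apply: lbrs_min => // x y Sx _; move: x Sx.
  apply: lbrs_min; first exact: subspace_lbrl.
  move=> x w [a Ra] _; rewrite -[x](subrK (a *: z)).
  move: (x - a *: z) Ra => r Rr; rewrite !lbrDl.
  apply: subspaceD => //; first by apply: Uden; apply: den1.
  by rewrite !lbrZl; apply: subspaceZ.
move: x (gf x); apply: lspan_min.
  by apply: (subspace_lbrr z (subspace_lbrl y sU)).
move=> x [[i ->{x}]|x2|Rx]; last by apply: Uden; apply: den2.
  move: y (gf y); apply: lspan_min; first exact: subspace_lbrr.
  move=> y [[j ->]|y2|Ry]; last by apply: Uden; apply: den3.
    by apply: (@span_mod_mem _ _ _ _
      (fun ij : 'I_d * 'I_d => lbr (lbr z (f ij.1)) (f ij.2)) (i, j)).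
  by apply: Uden; apply: den_pow2r.
(* For [x] in [F^2], Jacobi expands [[z,[p,q]]] into brackets that start with [[z,p]] and [[z,q]],
   both in [R]. *)
apply: Uden; move: x x2.
apply: lbrs_min; first by apply: (subspace_lbrr z (subspace_lbrl y den_subspace)).
move=> p q _ _; have -> : lbr z (lbr p q) = lbr (lbr z p) q - lbr (lbr z q) p.
  by rewrite (lbrC z (lbr p q)) lbr_lbr (lbrC p z) (lbrC q z) !lbrNl !opprK opprD !opprK.
by rewrite lbrBl; apply: subspaceB => //; apply: den1.
Qed.

End Multiplier.
End LieTheory.

(* Indices of the basic commutators [[f i, f j], f k]. *)
Definition is_basic d (t : 'I_d * 'I_d * 'I_d) := (t.1.2 < t.1.1)%N && (t.1.2 <= t.2)%N.
Definition basic d := {t : 'I_d * 'I_d * 'I_d | is_basic t}.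

(** A fixed [j] leaves [d - j - 1] choices of [i] and [d - j] choices of [k]. The count
    [(d^3 - d)/3] is stated without division or subtraction. *)
Lemma card_basic d : (3 * #|{: basic d}| + d = d ^ 3)%N.
Proof.
have cgt (j : 'I_d) : (\sum_(i < d | j < i) 1 = d - j.+1)%N.
  rewrite -(big_mkord (fun i => j < i)%N (fun _ => 1%N)) (big_cat_nat (n := j.+1)) //=.
  rewrite big_nat_cond big_pred0 ?add0n; last first.
    by move=> i; rewrite ltnS; case: (leqP i j) => // _; rewrite andbF.
  rewrite big_nat_cond (eq_bigl (fun i => (j.+1 <= i < d)%N && true)); last first.
    by move=> i; rewrite -andbA; case: (j < i)%N => //; rewrite andbT.
  by rewrite -big_nat_cond sum_nat_const_nat muln1.
have cge (j : 'I_d) : (\sum_(k < d | j <= k) 1 = d - j)%N.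
  rewrite (bigD1 j) //= (eq_bigl (fun i : 'I_d => (j < i)%N)); last first.
    by move=> i; rewrite andbC ltn_neqAle eq_sym.
  by rewrite cgt; have := ltn_ord j; lia.
have -> : #|{: basic d}| = (\sum_(j < d) (d - j.+1) * (d - j))%N.
  rewrite card_sig -sum1_card -(pair_big_dep xpredT (fun p k => is_basic (p, k)) (fun _ _ => 1%N)) /=.
  rewrite -(pair_big_dep xpredT (fun _ _ => true) (fun i j => \sum_(k < d | is_basic (i, j, k)) 1)%N) /=.
  rewrite exchange_big /=; apply: eq_bigr => j _.
  rewrite -cgt big_distrl /= [RHS]big_mkcond; apply: eq_bigr => i _.
  case: ltnP => [ltji|leij].
    by rewrite mul1n -cge; apply: eq_bigl => k; rewrite /is_basic /= ltji.
  by apply: big_pred0 => k; rewrite /is_basic /= ltnNge leij.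
(* Reversing the order of [j] turns the summand into [j (j + 1)], which suits induction on [d]. *)
rewrite (reindex_inj rev_ord_inj) /=.
rewrite (eq_bigr (fun j : 'I_d => j * j.+1)%N); last first.
  move=> j _; have := ltn_ord j; move: (nat_of_ord j) => a lta.
  by rewrite subnSK // !subKn // ltnW.
rewrite -(big_mkord xpredT (fun j => j * j.+1)%N).
elim: d {cgt cge} => [|d IH]; first by rewrite big_geq.
rewrite big_nat_recr //=; move: (\sum_(0 <= i < d) _)%N IH => t; rewrite !expnS expn0; nia.
Qed.

(** * Spanning families for [F^3] and for the numerator modulo [[[R,F],F]] *)

Section UpperBound.
Variables (K : fieldType) (L : lieAlgType K).
Implicit Types (R U : L -> Prop).

Definition basic_comm d (f : 'I_d -> L) (t : basic d) :=
  let: (i, j, k) := val t in lbr (lbr (f i) (f j)) (f k).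

(** For [k < j < i], Jacobi gives [[[i,j],k] = [[i,k],j] - [[j,k],i]], and both terms on the right
    are basic; antisymmetry covers the other orders of [i] and [j]. *)
Lemma basic_span d (f : 'I_d -> L) U : subspace U ->
  (forall t, U (basic_comm f t)) ->
  forall i j k, U (lbr (lbr (f i) (f j)) (f k)).
Proof.
move=> sU Ub.
have {}Ub (i j k : 'I_d) : (j < i)%N -> (j <= k)%N -> U (lbr (lbr (f i) (f j)) (f k)).
  move=> ji jk; have b : is_basic (i, j, k) by apply/andP.
  exact: (Ub (Sub (i, j, k) b)).
have Ug (i j k : 'I_d) : (j < i)%N -> U (lbr (lbr (f i) (f j)) (f k)).
  move=> ji; case: (leqP j k) => [jk|kj]; first exact: Ub.
  rewrite lbr_lbr; apply: subspaceB => //; apply: Ub => //.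
  - exact: ltn_trans ji.
  - exact: ltnW.
  exact/ltnW/(ltn_trans kj).
move=> i j k; case: (ltngtP i j) => [ij|ji|/val_inj->]; last first.
- by rewrite lbr_alt lbr0l; apply: subspace0.
- exact: Ug.
by rewrite (lbrC (f i)) lbrNl; apply: subspaceN => //; apply: Ug.
Qed.

(** Each entry of a triple commutator may be taken to be some [f i], or in [F^2], or in [R]. Three
    [f i] reduce to basic commutators. An entry of [F^2] in the first two places gives [[[z,x],y]]
    terms modulo [den]; in the last place it gives only [den], by [den_z]. *)
Lemma pow3_span R z d (f : 'I_d -> L) U : ideal R -> subspace U ->
  (forall x, den R x -> U x) -> lie_pow L 2 z ->
  (forall x, lie_pow L 2 x -> addR R z x) -> (forall x, fgens R f x) ->
  (forall t, U (basic_comm f t)) ->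
  (forall x y, U (lbr (lbr z x) y)) ->
  forall x, lie_pow L 3 x -> U x.
Proof.
move=> idR sU dU z2 L2z gf Ub Uz.
suff U3 x y w : U (lbr (lbr x y) w).
  apply: lbrs_min => // x w x2 _; move: x x2.
  by apply: lbrs_min => //; apply: subspace_lbrl.
have U1 a b c : lie_pow L 2 a \/ R a -> U (lbr (lbr a b) c).
  case=> [/L2z[e]|Ra]; last by apply: dU; apply: den1.
  rewrite -{2}[a](subrK (e *: z)); move: (a - _) => r Rr.
  rewrite !lbrDl !lbrZl; apply: subspaceD => //; first by apply: dU; apply: den1.
  exact: subspaceZ.
move: x (gf x); apply: lspan_min; first exact: (subspace_lbrl y (subspace_lbrl w sU)).
move=> x [[i ->{x}]|x2|Rx]; [|by apply: U1; left|by apply: U1; right].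
have U2 a b c : lie_pow L 2 b \/ R b -> U (lbr (lbr a b) c).
  by move=> /U1 Ub'; rewrite (lbrC a) lbrNl; apply: subspaceN.
move: y (gf y); apply: lspan_min; first exact: (subspace_lbrr (f i) (subspace_lbrl w sU)).
move=> y [[j ->{y}]|y2|Ry]; [|by apply: U2; left|by apply: U2; right].
move: w (gf w); apply: lspan_min; first by apply: subspace_lbrr.
move=> w [[k ->{w}]|/L2z[e Re]|Rw]; last by apply: dU; apply: den3.
  exact: (basic_span sU Ub).
apply: dU; rewrite -[w](subrK (e *: z)) lbrDr lbrZr.
apply: subspaceD; first exact: den_subspace.
  exact: den3.
by apply: subspaceZ; [exact: den_subspace | apply: den_z => //; apply: L2z; apply: lie_pow2].
Qed.

(* With [z = [p,q]], Jacobi gives [[z,w] = [[p,w],q] - [[q,w],p]], and both inner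
   brackets are multiples of [z] modulo [R]. *)
Lemma z_reduce R p q U w l : ideal R -> subspace U -> (forall x, den R x -> U x) ->
  (forall x, lie_pow L 2 x -> addR R (lbr p q) x) ->
  U (lbr (lbr (lbr p q) p) l) -> U (lbr (lbr (lbr p q) q) l) ->
  U (lbr (lbr (lbr p q) w) l).
Proof.
move=> idR sU dU L2z Up Uq.
have red x y : U (lbr (lbr (lbr p q) y) l) -> U (lbr (lbr (lbr x w) y) l).
  move=> Uy; have [a Ra] := L2z _ (lie_pow2 x w).
  rewrite -[lbr x w](subrK (a *: lbr p q)); move: (_ - _) Ra => r Rr.
  rewrite !lbrDl !lbrZl; apply: subspaceD => //; last exact: subspaceZ.
  by apply: dU; apply: den1.
by rewrite (lbr_lbr p q w) lbrBl; apply: subspaceB => //; apply: red.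
Qed.

(** [z_reduce] brings one entry down to [p] or [q], and the symmetry of [[[z,x],y]] lets it act on
    the other entry as well. *)
Lemma z_span R p q U : ideal R -> subspace U -> (forall x, den R x -> U x) ->
  (forall x, lie_pow L 2 x -> addR R (lbr p q) x) ->
  U (lbr (lbr (lbr p q) p) p) -> U (lbr (lbr (lbr p q) p) q) ->
  U (lbr (lbr (lbr p q) q) q) ->
  forall w l, U (lbr (lbr (lbr p q) w) l).
Proof.
move=> idR sU dU L2z Upp Upq Uqq.
have sym x y : U (lbr (lbr (lbr p q) x) y) -> U (lbr (lbr (lbr p q) y) x).
  move=> Uxy; rewrite -[X in U X](subrK (lbr (lbr (lbr p q) x) y)).
  apply: subspaceD => //; apply: dU; apply: den_z_sym => //; first exact: lie_pow2.
  by apply: L2z; apply: lie_pow2.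
move=> w l; apply: (z_reduce _ idR) => //; apply: (sym); apply: (z_reduce _ idR) => //.
exact: sym.
Qed.

(** Modulo [R], [[x,y]] is a nonzero multiple of [z = [p,q]]. Jacobi writes [[[x,y],p]] through
    [[x,p]] and [[y,p]], both in [R], and likewise for [q]; hence [[[z,p],l]] and [[[z,q],l]] are in
    [den], and [z_reduce] extends this to every [w]. *)
Lemma z_den R p q x y : ideal R ->
  (forall x, lie_pow L 2 x -> addR R (lbr p q) x) ->
  R (lbr x p) -> R (lbr x q) -> R (lbr y p) -> R (lbr y q) -> ~ R (lbr x y) ->
  forall w l, den R (lbr (lbr (lbr p q) w) l).
Proof.
move=> idR L2z xp xq yp yq nxy.
have sD := den_subspace R.
have [b Rb] := L2z _ (lie_pow2 x y).
have b0 : b != 0.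
  by apply/eqP => b0; apply: nxy; move: Rb; rewrite b0 scale0r subr0.
have red t l : R (lbr x t) -> R (lbr y t) -> den R (lbr (lbr (lbr p q) t) l).
  move=> xt yt; apply: (subspace_scaleK sD b0); rewrite -2!lbrZl.
  have -> : b *: lbr p q = lbr x y - (lbr x y - b *: lbr p q) by rewrite opprB addrC subrK.
  move: (_ - _) Rb => r Rr; rewrite !lbrBl; apply: subspaceB => //; last exact: den1.
  by rewrite (lbr_lbr x) lbrBl; apply: subspaceB => //; apply: den1.
by move=> w l; apply: (z_reduce _ idR) => //; apply: red.
Qed.

(** Such a [z] is found in the last term of the lower central series not contained in [R]: its
    brackets fall into the next term. *)
Lemma central_ex R c : ideal R -> (forall x, lie_pow L c x -> R x) ->
  ~ (forall x, lie_pow L 2 x -> R x) ->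
  exists z, [/\ lie_pow L 2 z, ~ R z & forall x, R (lbr z x)].
Proof.
move=> idR Rc nR2.
have {Rc} : exists c, forall x, lie_pow L c.+2 x -> R x.
  by exists c => x /lie_pow_anti/lie_pow_anti/Rc.
case=> {}c; elim: c => [//|c IH] Rc.
case: (classic (forall x, lie_pow L c.+2 x -> R x)) => [/IH//|nRc].
have [z nz] := not_all_ex_not _ _ nRc; have [zc nRz] := imply_to_and _ _ nz.
exists z; split=> //; first exact: lie_pow_sub2 zc.
by move=> x; apply: Rc; apply: lie_powS.
Qed.

(** Some bracket [[p,q]] is outside [R], since otherwise [F^2], and with it [z], would be inside. It
    equals [a z] modulo [R] with [a] nonzero, so it can replace [z]. *)
Lemma bracket_pair_ex R z : ideal R -> ~ R z -> lie_pow L 2 z -> (forall x, R (lbr z x)) ->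
  (forall x, lie_pow L 2 x -> addR R z x) ->
  exists p q, [/\ ~ R (lbr p q), forall x, R (lbr (lbr p q) x)
    & forall x, lie_pow L 2 x -> addR R (lbr p q) x].
Proof.
move=> idR nRz z2 zR L2z; have sR := idR.1.
have [p [q npq]] : exists p q, ~ R (lbr p q).
  apply: NNPP => npq; apply: nRz; move: z z2 {zR L2z}; apply: lbrs_min => // p q _ _.
  by apply: NNPP => nR; apply: npq; exists p, q.
have [a Ra] := L2z _ (lie_pow2 p q).
have a0 : a != 0.
  by apply/eqP => a0; apply: npq; move: Ra; rewrite a0 scale0r subr0.
exists p, q; split=> // x.
  rewrite -[lbr p q](subrK (a *: z)) lbrDl lbrZl.
  by apply: subspaceD => //; [apply: idR.2 | apply: subspaceZ].
case/L2z=> b Rb; exists (b / a).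
have := subspaceB sR Rb (subspaceZ (b / a) sR Ra); congr R.
by rewrite scalerBr scalerA divfK // opprB addrA subrK.
Qed.

Lemma pow2_sub_pow3_span R d (f : 'I_d -> L) : ideal R ->
  (forall x, lie_pow L 2 x -> R x) -> (forall x, fgens R f x) ->
  forall x, lie_pow L 3 x -> span_mod (den R) (basic_comm f) x.
Proof.
move=> idR R2 gf; have sD := den_subspace R.
have sU := span_mod_subspace (basic_comm f) sD.
(* With [F^2] inside [R] the value [z = 0] will do, and no terms [[[z,x],y]] remain. *)
apply: (pow3_span (z := 0) idR sU _ _ _ gf).
- by move=> x; apply: span_mod_sub.
- by apply: subspace0; apply: (lie_pow_subspace L 2).
- by move=> x /R2; apply: R_addR.
- by move=> t; apply: span_mod_mem.
by move=> x y; rewrite !lbr0l; apply: subspace0.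
Qed.

(** Induction on [m]. A central [z] enlarges [R] to [S = R + <z>], for which one spanning vector
    fewer is needed. As [R] lies in [S], the family for [S] together with the [d^2] elements of
    [den_addR] serves for [R]. The case [F^2] inside [R] recurs because [v] is only assumed to
    span. *)
Lemma mult2_span R c d (f : 'I_d -> L) m (v : 'I_m.+1 -> L) : ideal R ->
  (forall x, lie_pow L c x -> R x) -> (forall x, fgens R f x) ->
  (forall x, lie_pow L 2 x -> span_mod R v x) ->
  exists (I : finType) (w : I -> L),
    (#|I| <= #|{: basic d}| + 3 + d ^ 2 * m)%N /\
    forall x, R x -> lie_pow L 3 x -> span_mod (den R) w x.
Proof.
elim: m R v => [|m IH] R v idR Rc gf gv;
  (case: (classic (forall x, lie_pow L 2 x -> R x)) => [R2|nR2];
    first by exists (basic d); eexists; split=> [|x _]; [by rewrite -addnA leq_addr|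
      exact: pow2_sub_pow3_span]);
  have [z [z2 nRz zR]] := central_ex idR Rc nR2;
  have [w gw] := span_mod_exchange idR.1 gv z2 nRz.
- have L2z x : lie_pow L 2 x -> addR R z x.
    by move=> /gw[? []] a; rewrite big_ord0 subr0 => Ra; exists a.
  have [p [q [npq pqR {}L2z]]] := bracket_pair_ex idR nRz z2 zR L2z.
  pose e (i : 'I_3) := [:: lbr (lbr (lbr p q) p) p; lbr (lbr (lbr p q) p) q;
    lbr (lbr (lbr p q) q) q]`_i.
  pose u (s : basic d + 'I_3) := match s with inl t => basic_comm f t | inr i => e i end.
  exists (basic d + 'I_3)%type, u; split; first by rewrite card_sum card_ord muln0 addn0.
  move=> x _; have sD := den_subspace R.
  have sU := span_mod_subspace u sD.
  have dU y : den R y -> span_mod (den R) u y by apply: span_mod_sub.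
  apply: (pow3_span (z := lbr p q) idR sU dU (lie_pow2 p q) L2z gf).
    by move=> t; apply: (span_mod_mem u (inl t) sD).
  apply: (z_span idR sU dU L2z).
  + by have := span_mod_mem u (inr (inord 0)) sD; rewrite /u /e inordK.
  + by have := span_mod_mem u (inr (inord 1)) sD; rewrite /u /e inordK.
  + by have := span_mod_mem u (inr (inord 2)) sD; rewrite /u /e inordK.
have idS := addR_ideal idR zR.
have [|||I [u [cI gu]]] := IH (addR R z) w idS.
- by move=> x /Rc; apply: R_addR.
- move=> x; move: (gf x); apply: lspan_min; first exact: lspan_subspace.
  move=> y [[i ->]|y2|Ry]; apply: mem_lspan; [by constructor 1; exists i|by constructor 2|].
  by constructor 3; apply: R_addR.
- exact: gw.
have dS := den_addR zR gf.
exists (I + 'I_d * 'I_d)%type; eexists; split; last first.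
  by move=> x Rx x3; apply: (span_mod_trans dS (gu x (R_addR z Rx) x3)).
rewrite card_sum card_prod card_ord; move: cI; rewrite mulnS mulnn; lia.
Qed.

End UpperBound.

(** * Lie homomorphisms, their kernels, and uniqueness on a free algebra *)

Section Homs.
Variable K : fieldType.

Lemma lie_hom0 (L M : lieAlgType K) (f : L -> M) : lie_hom f -> f 0 = 0.
Proof. by case=> lf _; have := lf (-1) 0 0; rewrite scaler0 addr0 scaleN1r addNr. Qed.

Lemma lie_homZ (L M : lieAlgType K) (f : L -> M) a x : lie_hom f -> f (a *: x) = a *: f x.
Proof.
by move=> hf; have := hf.1 a x 0; rewrite addr0 (lie_hom0 hf) addr0.
Qed.

Lemma lie_homD (L M : lieAlgType K) (f : L -> M) x y : lie_hom f -> f (x + y) = f x + f y.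
Proof. by move=> hf; have := hf.1 1 x y; rewrite !scale1r. Qed.

Lemma lie_homB (L M : lieAlgType K) (f : L -> M) x y : lie_hom f -> f (x - y) = f x - f y.
Proof. by move=> hf; rewrite lie_homD // -!scaleN1r lie_homZ. Qed.

Lemma lie_hom_sum (L M : lieAlgType K) (f : L -> M) (I : finType) (F : I -> L) : lie_hom f ->
  f (\sum_i F i) = \sum_i f (F i).
Proof.
move=> hf; apply: (big_morph f) => [x y|]; first exact: lie_homD.
exact: lie_hom0.
Qed.

Lemma lie_hom_comp (L M N : lieAlgType K) (f : L -> M) (g : M -> N) :
  lie_hom f -> lie_hom g -> lie_hom (g \o f).
Proof.
move=> [lf bf] [lg bg]; split=> [a x y|x y] /=; first by rewrite lf lg.
by rewrite bf bg.
Qed.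

Lemma free_hom_eq (X : Type) (F M : lieAlgType K) (iX : X -> F) (g h : F -> M) :
  free_on iX -> lie_hom g -> lie_hom h -> (forall x, g (iX x) = h (iX x)) -> g =1 h.
Proof.
move=> fr hg hh gh; have [e [_ _ ue]] := fr M (g \o iX).
by move=> y; rewrite (ue g) // (ue h) // => x; rewrite -gh.
Qed.

Lemma ker_ideal (L M : lieAlgType K) (f : L -> M) : lie_hom f -> ideal (ker_of f).
Proof.
move=> hf; rewrite /ker_of; split; first split; first exact: lie_hom0.
  by move=> a x y fx fy; rewrite hf.1 fx fy scaler0 addr0.
by move=> x y fx; rewrite hf.2 fx lbr0l.
Qed.

Lemma lie_hom_pow (L M : lieAlgType K) (f : L -> M) k x : lie_hom f ->
  lie_pow L k x -> lie_pow M k (f x).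
Proof.
move=> hf; elim: k x => [//|[//|k] IH].
have [s0 sD] := lie_pow_subspace M k.+2.
apply: lbrs_min.
  split; first by rewrite lie_hom0.
  by move=> a x y Mx My; rewrite hf.1; apply: sD.
by move=> x y Lx _; rewrite hf.2; apply: lie_powS; apply: IH.
Qed.

End Homs.

(** * The metabelian algebras used to test independence *)

Section Filiform.
Variable K : fieldType.

(* [K] acting on the truncated polynomials [K[X]/X^r] by multiplication by ['X];
   elements are pairs whose polynomial part is only truncated by the bracket. *)
Definition fili (r : nat) := (K^o * {poly K})%type.
HB.instance Definition _ r := GRing.Lmodule.on (fili r).

Variable r : nat.
Local Notation T := (fili r).

Definition fili_br (x y : T) : T :=
  (0, take_poly r ('X * (x.1 *: y.2 - y.1 *: x.2))).

Lemma fili_linr a (x y z : T) :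
  fili_br z (a *: x + y) = a *: fili_br z x + fili_br z y.
Proof.
congr pair; rewrite /= ?scaler0 ?addr0 //.
apply/polyP => i; rewrite !(coefE, coef_take_poly).
by case: ifP => _; case: (i == 0)%N; rewrite ?mulr0 ?addr0 //; rewrite -?[_ *: _]/(_ * _); ring.
Qed.

Lemma fili_anti (x y : T) : fili_br x y = - fili_br y x.
Proof.
congr pair; rewrite /= ?oppr0 //.
apply/polyP => i; rewrite !(coefE, coef_take_poly).
by case: ifP => _; case: (i == 0)%N; rewrite ?oppr0 ?opprB.
Qed.

Lemma fili_linl a (x y z : T) :
  fili_br (a *: x + y) z = a *: fili_br x z + fili_br y z.
Proof. by rewrite !(fili_anti _ z) fili_linr opprD scalerN. Qed.

Lemma fili_alt (x : T) : fili_br x x = 0.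
Proof. by rewrite /fili_br subrr mulr0 take_poly0r. Qed.

Lemma fili_jacobi (x y z : T) :
  fili_br x (fili_br y z) + fili_br y (fili_br z x) + fili_br z (fili_br x y) = 0.
Proof.
congr pair; rewrite /= ?addr0 //.
apply/polyP => i; rewrite !(coefE, coef_take_poly).
case: i => [|i] /=; first by rewrite if_same !addr0.
case: ltnP => [ir|]; last by rewrite !addr0.
rewrite !mul0r !subr0; case: i ir => [|i] ir /=; first by rewrite !(if_same, mulr0, addr0).
rewrite (ltnW ir) /=; ring.
Qed.

HB.instance Definition _ :=
  isLieAlgebra.Build K T fili_linl fili_linr fili_alt fili_jacobi.

Definition Fili : lieAlgType K := T.

Lemma fili1 (x y : Fili) : (lbr x y).1 = 0 :> K. Proof. by []. Qed.

Lemma fili20 (x y : Fili) : (lbr x y).2`_0 = 0.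
Proof. by rewrite coef_take_poly coefXM eqxx if_same. Qed.

Lemma fili2S (x y : Fili) i : (i.+1 < r)%N ->
  (lbr x y).2`_i.+1 = (x.1 : K) * y.2`_i - (y.1 : K) * x.2`_i.
Proof. by move=> ir; rewrite coef_take_poly ir coefXM /= !coefE. Qed.

End Filiform.

(** * Independence of the spanning family for [H(1) + A(k)] *)

Section LowerBound.
Variable K : fieldType.

(** Freeness extends the values of [theta \o pi] on the generators, read in [Fili K s], to all of
    [F]. Truncation at [r] is a homomorphism, so by uniqueness the two maps agree below degree
    [r]. *)
Lemma fili_lift r s (X : Type) (F L : lieAlgType K) (iX : X -> F) (pi : F -> L)
    (theta : L -> Fili K r) : (r <= s)%N ->
  free_on iX -> lie_hom pi -> lie_hom theta ->
  exists g : F -> Fili K s, [/\ lie_hom g, forall x, (g x).1 = (theta (pi x)).1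
    & forall x i, (i < r)%N -> (g x).2`_i = (theta (pi x)).2`_i].
Proof.
move=> rs fr hpi hth.
have [g [hg gX _]] := fr (Fili K s) (fun x => theta (pi (iX x))).
(* Both sides have to be truncated: elements of [Fili K r] itself may carry coefficients of degree
   [r] and above. *)
pose trunc t (x : Fili K t) : Fili K r := (x.1, take_poly r x.2).
have htr t : (r <= t)%N -> lie_hom (trunc t).
  move=> rt; split=> [a x y|x y]; congr pair; rewrite /=.
    by rewrite take_polyD take_polyZ.
  apply/polyP => i; rewrite !coef_take_poly !coefXM; case: i => [|i] /=; first by rewrite !if_same.
  case: ltnP => [ir|//]; rewrite (leq_trans ir rt) !(coefB, coefZ, coef_take_poly) (ltnW ir) //.
have e := free_hom_eq fr (lie_hom_comp hg (htr s rs))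
  (lie_hom_comp (lie_hom_comp hpi hth) (htr r (leqnn r))).
have {}e x : trunc s (g x) = trunc r (theta (pi x)).
  by apply: e => y /=; rewrite gX.
exists g; split=> // x; first by have [] := e x.
move=> i ir; have [_ /polyP/(_ i)] := e x; by rewrite !coef_take_poly ir.
Qed.

(** An element of the kernel is sent to a polynomial of order at least [r], and each bracket raises
    the order by one; two brackets push it beyond degree [r + 1]. *)
Lemma fili_den r (F L : lieAlgType K) (pi : F -> L)
    (theta : L -> Fili K r) (g : F -> Fili K r.+2) : lie_hom theta -> lie_hom g ->
  (forall x, (g x).1 = (theta (pi x)).1) ->
  (forall x i, (i < r)%N -> (g x).2`_i = (theta (pi x)).2`_i) ->
  forall x, mult2_den pi x -> (g x).2`_r.+1 = 0.
Proof.
move=> hth hg g1 g2.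
have sub (P : Fili K r.+2 -> Prop) : subspace P -> subspace (fun x => P (g x)).
  move=> [P0 PD]; split; first by rewrite lie_hom0.
  by move=> a x y Px Py; rewrite hg.1; apply: PD.
have shift i (x y : Fili K r.+2) : (i <= r.+1)%N -> x.1 = 0 ->
    (forall j, (j < i)%N -> x.2`_j = 0) -> forall j, (j < i.+1)%N -> (lbr x y).2`_j = 0.
  move=> ir x1 x2 [_|j ji]; first by rewrite fili20.
  by rewrite fili2S ?(leq_trans ji) // x1 mul0r x2 // mulr0 subrr.
have low i : subspace (fun x : Fili K r.+2 => x.1 = 0 /\ forall j, (j < i)%N -> x.2`_j = 0).
  split; first by split=> // j _; rewrite coef0.
  move=> a x y [x1 x2] [y1 y2]; split; first by rewrite /= x1 y1 scaler0 addr0.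
  by move=> j ji; rewrite /= coefD coefZ x2 // y2 // mulr0 addr0.
suff H : forall x, mult2_den pi x -> (g x).1 = 0 /\ forall j, (j < r.+2)%N -> (g x).2`_j = 0.
  by move=> x /H[_]; apply.
apply: lbrs_min; first exact: (sub _ (low _)).
move=> x y xR _; rewrite hg.2; split=> //; move: x xR.
suff H : forall x, lbrs (ker_of pi) (@allv K F) x ->
    (g x).1 = 0 /\ forall j, (j < r.+1)%N -> (g x).2`_j = 0.
  by move=> x /H[x1 x2]; apply: shift.
apply: lbrs_min; first exact: (sub _ (low _)).
move=> x {}y xR _; rewrite hg.2; split=> //; apply: shift => //.
  by rewrite g1 xR (lie_hom0 hth).
by move=> j jr; rewrite g2 // xR (lie_hom0 hth) coef0.
Qed.

Section HAbound.
Variable k : nat.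
Local Notation H := (HA K k).
Local Notation i2 := (inord 2 : 'I_k.+3).

(* The positions of the generators of [H(1) + A(k)]: all but the central [e_2]. *)
Definition hgen (j : 'I_k.+2) : 'I_k.+3 := lift i2 j.

Lemma hgen_neq j : (hgen j == i2) = false.
Proof. by rewrite eq_sym; apply/negbTE/neq_lift. Qed.

Lemma hgen0 : hgen ord0 = inord 0.
Proof. by apply/val_inj; rewrite /= /bump !inordK. Qed.

Lemma hgen1 : hgen (inord 1) = inord 1.
Proof. by apply/val_inj; rewrite /= /bump !inordK. Qed.

Lemma HA_lbr (v w : H) : lbr v w = HA_br v w. Proof. by []. Qed.

Lemma HA_lbrE (v w : H) j : (lbr v w : 'rV_k.+3) 0 j =
  (v 0 (inord 0) * w 0 (inord 1) - v 0 (inord 1) * w 0 (inord 0)) * (j == i2)%:R.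
Proof. by rewrite HA_lbr !mxE. Qed.

(** Two arbitrary linear forms vanishing on [e_2], which spans the derived algebra; the target
    [Fili K 1] has zero bracket. *)
Definition theta1 (c u : 'I_k.+2 -> K) (v : H) : Fili K 1 :=
  (\sum_j c j * v 0 (hgen j), (\sum_j u j * v 0 (hgen j))%:P).

Lemma HA_linE b (v w : H) j : (b *: v + w : 'rV_k.+3) 0 j = b * v 0 j + w 0 j.
Proof. by rewrite !mxE. Qed.

Lemma hsum_lin (c : 'I_k.+2 -> K) b (v w : H) :
  \sum_j c j * (b *: v + w : 'rV_k.+3) 0 (hgen j) =
  b * (\sum_j c j * v 0 (hgen j)) + \sum_j c j * w 0 (hgen j).
Proof.
rewrite mulr_sumr -big_split; apply: eq_bigr => j _ /=.
by rewrite HA_linE; ring.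
Qed.

Lemma theta1_hom c u : lie_hom (theta1 c u).
Proof.
split=> [b v w|v w]; congr pair; rewrite /=.
- exact: hsum_lin.
- by rewrite hsum_lin polyCD polyCM mul_polyC.
- by apply: big1 => j _; rewrite HA_lbrE hgen_neq !mulr0.
apply/polyP => i; rewrite coef_take_poly coefXM coefC.
case: i => //=; apply: big1 => j _; by rewrite HA_lbrE hgen_neq !mulr0.
Qed.

(** Kills the summand [A(k)]; the coefficient of ['X] is dictated by [[e_0,e_1] = e_2]. *)
Definition theta2 (c0 c1 u0 u1 : K) (v : H) : Fili K 2 :=
  (c0 * v 0 (inord 0) + c1 * v 0 (inord 1),
   (u0 * v 0 (inord 0) + u1 * v 0 (inord 1))%:P + (v 0 i2 * (c0 * u1 - c1 * u0)) *: 'X).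

Lemma theta2_hom c0 c1 u0 u1 : lie_hom (theta2 c0 c1 u0 u1).
Proof.
have n0 : (inord 0 == i2) = false by rewrite -hgen0 hgen_neq.
have n1 : (inord 1 == i2) = false by rewrite -hgen1 hgen_neq.
split=> [b v w|v w]; congr pair; rewrite /=.
- rewrite !HA_linE [RHS](_ : _ = b * (c0 * v 0 (inord 0) + c1 * v 0 (inord 1)) +
    (c0 * w 0 (inord 0) + c1 * w 0 (inord 1))) //; ring.
- by rewrite !HA_linE; apply/polyP => i; rewrite !(coefD, coefZ, coefC, coefX);
    case: (i == 0)%N; case: (i == 1)%N; ring.
- by rewrite !HA_lbrE n0 n1 !mulr0 addr0.
apply/polyP => i; rewrite coef_take_poly coefXM coefD coefC coefZ coefX !HA_lbrE n0 n1 eqxx.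
case: i => [|[|i]] /=; rewrite ?(mulr0, addr0, mulr1, add0r) //.
rewrite !coefE /=; ring.
Qed.

Variables (X : Type) (F : lieAlgType K) (iX : X -> F) (pi : F -> H).
Hypotheses (fr : free_on iX) (hpi : lie_hom pi).
Variable f : 'I_k.+2 -> F.
Hypothesis pif : forall j, pi (f j) = delta_mx 0 (hgen j).

Definition hz := lbr (f ord0) (f (inord 1)).

Definition hext (i : 'I_3) := [:: lbr (lbr hz (f ord0)) (f ord0);
  lbr (lbr hz (f ord0)) (f (inord 1)); lbr (lbr hz (f (inord 1))) (f (inord 1))]`_i.

Definition hfam (s : basic k.+2 + 'I_3) :=
  match s with inl t => basic_comm f t | inr i => hext i end.

Variable a : basic k.+2 + 'I_3 -> K.
Hypothesis ha : mult2_den pi (\sum_s a s *: hfam s).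

Lemma sum_delta (c : 'I_k.+2 -> K) j :
  \sum_i c i * (delta_mx 0 (hgen j) : 'rV[K]_k.+3) 0 (hgen i) = c j.
Proof.
rewrite (bigD1 j) //= mxE !eqxx mulr1 big1 ?addr0 // => i ij.
by rewrite mxE /= (inj_eq lift_inj) (negPf ij) mulr0.
Qed.

(** The coefficient of degree 2 of the image of the relation [a] under a lift of [theta1 c u] to
    [Fili K 3]. *)
Definition cubic (c u : 'I_k.+2 -> K) :=
  \sum_(t : basic k.+2) a (inl t) *
    (let: (i, j, l) := val t in c l * (c j * u i - c i * u j)).

Lemma cubic_eq0 c u : cubic c u = 0.
Proof.
have [g [hg g1 g2]] := fili_lift (isT : (1 <= 3)%N) fr hpi (theta1_hom c u).
have := fili_den (theta1_hom c u) hg g1 g2 ha.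
have gf1 j : (g (f j)).1 = c j :> K by rewrite g1 pif /= sum_delta.
have gf2 j : (g (f j)).2`_0 = u j by rewrite g2 // pif /= coefC /= sum_delta.
rewrite (lie_hom_sum _ hg).
have -> : (\sum_i g (a i *: hfam i)).2`_2 = \sum_i a i * (g (hfam i)).2`_2.
  rewrite (big_morph (fun x : Fili K 3 => x.2`_2) (id1 := 0) (op1 := +%R)) //=;
      last by rewrite coef0.
    by apply: eq_bigr => i _; rewrite lie_homZ //= coefZ.
  by move=> x y; rewrite /= coefD.
rewrite big_sumType /= [X in _ + X]big1 ?addr0; last first.
  (* [hz] is already a bracket, so two further brackets push it past degree 2: the three extra
     elements do not contribute. *)
  have z3 l m : (g (lbr (lbr hz (f l)) (f m))).2`_2 = 0.
    by rewrite !hg.2 fili2S // fili1 mul0r fili2S // fili1 fili20 mul0r mulr0 subrr mulr0 subrr.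
  by case=> [[|[|[|//]]] ?] _; rewrite /hext /= z3 mulr0.
move=> E0; rewrite -[RHS]E0; apply: eq_bigr => t _; congr (_ * _); rewrite /basic_comm.
case: t => [[[i j] l] tb] /=; rewrite !hg.2 fili2S // fili1 mul0r sub0r fili2S //.
by rewrite !gf1 !gf2; ring.
Qed.

(** [cubic] is quadratic in [c]; this is its polarization. *)
Lemma cubic_pol_eq0 (c e u : 'I_k.+2 -> K) :
  \sum_(t : basic k.+2) a (inl t) * (let: (i, j, l) := val t in
    (c l * e j + e l * c j) * u i - (c l * e i + e l * c i) * u j) = 0.
Proof.
transitivity (cubic (fun i => c i + e i) u - cubic c u - cubic e u); last first.
  by rewrite !cubic_eq0 !subr0.
rewrite -!sumrB; apply: eq_bigr => t _.
by case: t => [[[i j] l] tb] /=; ring.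
Qed.

Lemma bool3_eq0 (p q r : bool) : ~~ [&& p, q & r] -> p%:R * (q%:R * r%:R) = 0 :> K.
Proof. by case: p; case: q; case: r => //= _; rewrite ?(mul0r, mulr0). Qed.

(** Evaluation at Kronecker deltas isolates the coefficient of [(i,j,l)], since the inequalities on
    basic indices exclude all other matches. For [l = j] the quadratic form itself is used: its
    polarization would introduce a factor 2, fatal in characteristic 2. *)
Lemma basic_coef0 t : a (inl t) = 0.
Proof.
case E : t => [[[i j] l] b]; rewrite -E; have /andP[/= ji jl] := b.
pose dl (x y : 'I_k.+2) : K := (y == x)%:R.
have other i' j' l' b' : Sub (i', j', l') b' != t -> ~~ [&& i' == i, j' == j & l' == l].
  by apply: contra => /and3P[/eqP ei /eqP ej /eqP el]; rewrite E -val_eqE /= ei ej el.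
have ij : (i == j) = false by apply/negbTE; rewrite neq_ltn ji orbT.
have [lj|lj] := eqVneq l j.
  have := cubic_eq0 (dl j) (dl i); rewrite /cubic (bigD1 t) //= {2}E /= lj /dl !eqxx ij.
  rewrite big1 => [|[[[i' j'] l'] b'] /other nt]; first by rewrite !mul0r subr0 !mulr1 addr0.
  have /andP[/= ji' jl'] := b'; rewrite mulrBr !bool3_eq0 ?subrr ?mulr0 //.
    by apply/negP => /and3P[/eqP el /eqP ei /eqP ej]; move: ji ji'; rewrite ei ej; lia.
  by apply: contra nt => /and3P[lh jh ih]; rewrite lj lh jh ih.
have jltl : (j < l)%N by rewrite ltn_neqAle jl andbT eq_sym.
have := cubic_pol_eq0 (dl j) (dl l) (dl i); rewrite (bigD1 t) //= {2}E /= /dl !eqxx ij.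
rewrite big1 => [|[[[i' j'] l'] b'] /other nt].
  rewrite (negPf lj) (eq_sym j l) (negPf lj) !(mul0r, mulr0, addr0, add0r, mulr1, subr0).
  by [].
have /andP[/= ji' jl'] := b'; rewrite !mulrDl -!mulrA !bool3_eq0 ?addr0 ?subrr ?mulr0 //.
- by apply/negP => /and3P[/eqP el /eqP ei /eqP ej]; move: ji ji'; rewrite ei ej; lia.
- by apply/negP => /and3P[/eqP el /eqP ei /eqP ej]; move: ji jl'; rewrite el ej; lia.
- by apply: contra nt => /and3P[lh jh ih]; rewrite lh jh ih.
by apply/negP => /and3P[/eqP el /eqP ej /eqP ei]; move: jl' jltl; rewrite el ej; lia.
Qed.

(** Once the basic coefficients are zero, the coefficient of degree 3 under lifts of [theta2] to
    [Fili K 4] is a binary quadratic form in [c0], [c1], with the three remaining coefficients,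
    times a determinant. *)
Lemma ext_coef0 i : a (inr i) = 0.
Proof.
pose z0 : 'I_3 := inord 0; pose z1 : 'I_3 := inord 1; pose z2 : 'I_3 := inord 2.
have eq0 (c0 c1 u0 u1 : K) : (a (inr z0) * (c0 * c0) + a (inr z1) * (c0 * c1)
    + a (inr z2) * (c1 * c1)) * (c0 * u1 - c1 * u0) = 0.
  have hth := theta2_hom c0 c1 u0 u1.
  have [g [hg g1 g2]] := fili_lift (isT : (2 <= 4)%N) fr hpi hth.
  have := fili_den hth hg g1 g2 ha.
  have dE (j l : 'I_k.+2) : (delta_mx 0 (hgen j) : 'rV[K]_k.+3) 0 (hgen l) = (l == j)%:R.
    by rewrite mxE /= (inj_eq lift_inj).
  have dE2 (j : 'I_k.+2) : (delta_mx 0 (hgen j) : 'rV[K]_k.+3) 0 i2 = 0.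
    by rewrite mxE /= eq_sym hgen_neq.
  have n01 : (ord0 == inord 1 :> 'I_k.+2) = false by rewrite -val_eqE /= inordK.
  have f01 : (g (f ord0)).1 = c0 :> K.
    by rewrite g1 pif /= -hgen0 -hgen1 !dE eqxx eq_sym n01 mulr1 mulr0 addr0.
  have f11 : (g (f (inord 1))).1 = c1 :> K.
    by rewrite g1 pif /= -hgen0 -hgen1 !dE eqxx n01 mulr1 mulr0 add0r.
  have f02 : (g (f ord0)).2`_0 = u0.
    rewrite g2 // pif /= -hgen0 -hgen1 dE2 !dE eqxx eq_sym n01 mul0r scale0r addr0 coefC /=.
    by rewrite mulr1 mulr0 addr0.
  have f12 : (g (f (inord 1))).2`_0 = u1.
    rewrite g2 // pif /= -hgen0 -hgen1 dE2 !dE eqxx n01 mul0r scale0r addr0 coefC /=.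
    by rewrite mulr1 mulr0 add0r.
  have z3 l m : (g (lbr (lbr hz (f l)) (f m))).2`_3 =
      (g (f m)).1 * ((g (f l)).1 * (c0 * u1 - c1 * u0)).
    rewrite !hg.2 fili2S // fili1 mul0r fili2S // fili1 mul0r fili2S // f01 f11 f02 f12; ring.
  rewrite (lie_hom_sum _ hg).
  have -> : (\sum_i g (a i *: hfam i)).2`_3 = \sum_i a i * (g (hfam i)).2`_3.
    rewrite (big_morph (fun x : Fili K 4 => x.2`_3) (id1 := 0) (op1 := +%R)) //=;
      last by rewrite coef0.
      by apply: eq_bigr => s _; rewrite lie_homZ //= coefZ.
    by move=> x y; rewrite /= coefD.
  rewrite big_sumType /= big1 ?add0r => [|t _]; last by rewrite basic_coef0 mul0r.
  rewrite !big_ord_recl big_ord0 addr0 /hext /= !z3 f01 f11.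
  have -> : lift ord0 (lift ord0 ord0) = z2 by apply: val_inj; rewrite /= inordK.
  have -> : lift ord0 ord0 = z1 by apply: val_inj; rewrite /= inordK.
  have -> : ord0 = z0 by apply: val_inj; rewrite /= inordK.
  by move=> E0; rewrite -[RHS]E0; ring.
(* The values make the determinant 1 or -1 and evaluate the form at [(1,0)], [(0,1)] and [(1,1)]. *)
have a0 : a (inr z0) = 0 by have := eq0 1 0 0 1; rewrite !(mulr0, mulr1, addr0, subr0).
have a2 : a (inr z2) = 0.
  have := eq0 0 1 1 0; rewrite !(mulr0, mulr1, add0r) mulrN mulr1.
  by move/eqP; rewrite oppr_eq0 => /eqP.
have a1 : a (inr z1) = 0.
  by have := eq0 1 1 0 1; rewrite a0 a2 !(mulr0, mul0r, mulr1, addr0, add0r, subr0).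
case: i => [[|[|[|//]]] im].
- by rewrite -{}a0; congr (a (inr _)); apply: val_inj; rewrite /= inordK.
- by rewrite -{}a1; congr (a (inr _)); apply: val_inj; rewrite /= inordK.
by rewrite -{}a2; congr (a (inr _)); apply: val_inj; rewrite /= inordK.
Qed.

End HAbound.

Lemma hfam_indep k (X : Type) (F : lieAlgType K) (iX : X -> F) (pi : F -> HA K k)
    (f : 'I_k.+2 -> F) : free_on iX -> lie_hom pi ->
  (forall j, pi (f j) = delta_mx 0 (hgen j)) -> indep_mod (mult2_den pi) (hfam f).
Proof.
move=> fr hpi pif a ha [t|i]; first exact: (basic_coef0 fr hpi pif ha).
exact: (ext_coef0 fr hpi pif ha).
Qed.

Lemma hfam_pow3 k (F : lieAlgType K) (f : 'I_k.+2 -> F) s : lie_pow F 3 (hfam f s).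
Proof.
have L3 x y z : lie_pow F 3 (lbr (lbr x y) z) by apply: lie_powS; apply: lie_pow2.
case: s => [[[[i j] l] b]|[[|[|[|//]]] im]] /=; exact: L3.
Qed.

Lemma HA_pow3 k x : lie_pow (HA K k) 3 x -> x = 0.
Proof.
move: x; apply: lbrs_min; first exact: subspace_eq0.
move=> y z y2 _; move: y y2; apply: lbrs_min => [|y w _ _].
  exact: (subspace_lbrl z (@subspace_eq0 _ (HA K k))).
by rewrite lbrC !HA_lbr HA_br_e2 oppr0.
Qed.

End LowerBound.

(** * Recognition of [H(1) + A(n-3)] *)

Section Isomorphism.
Variable K : fieldType.

Lemma sdim_rV (L : lmodType K) N (phi : 'rV[K]_N -> L) :
  (forall a u v, phi (a *: u + v) = a *: phi u + phi v) ->
  (forall u, phi u = 0 -> u = 0) -> (forall x, exists u, phi u = x) ->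
  sdim (@allv K L) N.
Proof.
move=> lin inj surj.
have phi0 : phi 0 = 0 by have := lin (-1) 0 0; rewrite scaler0 addr0 scaleN1r addNr.
have sumE (c : 'I_N -> K) : \sum_i c i *: phi (delta_mx 0 i) = phi (\row_i c i).
  have D u v : phi (u + v) = phi u + phi v by have := lin 1 u v; rewrite !scale1r.
  rewrite [in RHS](row_sum_delta (\row_i c i)) (big_morph phi D phi0); apply: eq_bigr => i _.
  by have := lin ((\row_i c i) 0 i) (delta_mx 0 i) 0; rewrite phi0 !addr0 mxE => ->.
exists (fun i => phi (delta_mx 0 i)); split=> //; split=> [c|x _].
  by rewrite sumE => /inj/rowP c0 i; have := c0 i; rewrite !mxE.
have [u <-] := surj x; exists (fun i => u 0 i); rewrite sumE.
have -> : \row_i u 0 i = u by apply/rowP => i; rewrite mxE.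
exact: subrr.
Qed.

Lemma lie_iso_rV (L : lieAlgType K) k (phi : HA K k -> L) : lie_hom phi ->
  (forall u, phi u = 0 -> u = 0) -> (forall x, exists u, phi u = x) ->
  lie_isomorphic L (HA K k).
Proof.
move=> hphi inj surj.
have ex x : exists u : 'rV[K]_k.+3, phi u == x by have [u <-] := surj x; exists u.
pose psi x : HA K k := xchoose (ex x).
have psiK x : phi (psi x) = x by apply/eqP/(xchooseP (ex x)).
have phiI u v : phi u = phi v -> u = v.
  by move=> e; apply/eqP; rewrite -subr_eq0; apply/eqP/inj; rewrite lie_homB // e subrr.
exists psi; split; first split.
- by move=> a x y; apply: phiI; rewrite hphi.1 !psiK.
- by move=> x y; apply: phiI; rewrite hphi.2 !psiK.
by exists phi => // u; apply: phiI; rewrite psiK.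
Qed.

(** The centralizer [C] of [p] and [q] is abelian, contains [z], and together with [p] and [q] spans
    [L]; a complement of [<z>] in [C] is the abelian summand. *)
Lemma lie_iso_HA (L : lieAlgType K) n (p q : L) : sdim (@allv K L) n ->
  lbr p q <> 0 -> (forall x, lbr (lbr p q) x = 0) ->
  (forall x y, exists a, lbr x y = a *: lbr p q) ->
  (forall x y, lbr x p = 0 -> lbr x q = 0 -> lbr y p = 0 -> lbr y q = 0 -> lbr x y = 0) ->
  lie_isomorphic L (HA K (n - 3)).
Proof.
set z := lbr p q => sn z0 zc L2 ab.
pose C x := lbr x p = 0 /\ lbr x q = 0; pose Z (x : L) := exists a, x = a *: z.
have sZ : subspace Z.
  split; first by exists 0; rewrite scale0r.
  by move=> a _ _ [b ->] [c ->]; exists (a * b + c); rewrite scalerDl scalerA.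
have [k [w [Cw [iw gw]]]] : exists k, qdim C Z k.
  have [b [_ [_ gb]]] := sn; apply: (qdim_ex (v := b) sZ) => x _.
  by have [c e] := gb x I; exists c, 0; rewrite scale0r; exact: e.
(* Positions 0, 1, 2 go to [p], [q], [z], the others to a basis of [C] modulo [<z>]. *)
pose phi (v : HA K k) : L := v 0 (inord 0) *: p + v 0 (inord 1) *: q + v 0 (inord 2) *: z
   + \sum_i v 0 (rshift 3 i) *: w i.
have lin a u v : phi (a *: u + v) = a *: phi u + phi v.
  rewrite /phi !HA_linE; under eq_bigr do rewrite HA_linE scalerDl -scalerA.
  rewrite big_split /= -scaler_sumr !scalerDl -!scalerA !scalerDr.
  by do 3 (rewrite [RHS]addrACA; congr (_ + _)).
have zz a x : lbr (a *: z) x = 0 by rewrite lbrZl zc scaler0.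
have zr a x : lbr x (a *: z) = 0 by rewrite lbrC zz oppr0.
have sC : subspace C.
  split; first by rewrite /C !lbr0l.
  by move=> a x y [xp xq] [yp yq]; rewrite /C !lbr_linl xp xq yp yq scaler0 addr0.
have Cs (c : 'I_k -> K) : C (\sum_i c i *: w i).
  by apply: subspace_sum => // i _; apply: subspaceZ.
have Cp x : C x -> lbr p x = 0 by case=> xp _; rewrite lbrC xp oppr0.
have Cq x : C x -> lbr q x = 0 by case=> _ xq; rewrite lbrC xq oppr0.
have hphi : lie_hom phi.
  split=> // u v; rewrite [in RHS]/phi.
  set s := \sum_i _; set t := \sum_i _.
  have Hs : C s by apply: Cs. have Ht : C t by apply: Cs.
  rewrite !(lbrDl, lbrDr) !zz !zr !lbrZl !lbrZr !lbr_alt (Cp t) // (Cq t) // Hs.1 Hs.2.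
  rewrite (ab s t Hs.1 Hs.2 Ht.1 Ht.2) (lbrC q p) !(scaler0, addr0, add0r).
  rewrite /phi !HA_lbrE !eqxx mulr1.
  have n0 : (inord 0 == inord 2 :> 'I_k.+3) = false by rewrite -hgen0 hgen_neq.
  have n1 : (inord 1 == inord 2 :> 'I_k.+3) = false by rewrite -hgen1 hgen_neq.
  rewrite n0 n1 !mulr0 !scale0r !add0r big1 => [|i _]; last first.
    rewrite HA_lbrE (_ : (_ == _) = false) ?mulr0 ?scale0r //.
    by apply/negbTE; rewrite -val_eqE /= inordK.
  by rewrite addr0 !scalerA scalerN scalerBl.
have inj u : phi u = 0 -> u = 0.
  move=> u0.
  (* Bracketing with [q] and [p] isolates the coordinates on [p] and [q]. *)
  have := congr1 (fun x => lbr x q) u0; have := congr1 (fun x => lbr x p) u0.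
  have Hs : C (\sum_i u 0 (rshift 3 i) *: w i) by apply: Cs.
  rewrite /= lbr0l /phi !lbrDl !zz Hs.1 Hs.2 !lbrZl !lbr_alt (lbrC q p).
  rewrite !(scaler0, addr0, add0r) lbr0l.
  have sz a : a *: z = 0 -> a = 0.
    by move/eqP; rewrite scaler_eq0 => /orP[/eqP//|/eqP/z0].
  rewrite scalerN => /eqP; rewrite oppr_eq0 => /eqP/sz u1 /sz u00.
  move: u0; rewrite /phi u1 u00 !scale0r !add0r => /eqP; rewrite addr_eq0 => /eqP uz.
  have ui : forall i, u 0 (rshift 3 i) = 0.
    by apply: iw; exists (- u 0 (inord 2)); rewrite scaleNr uz opprK.
  have u2 : u 0 (inord 2) = 0.
    by apply: sz; rewrite uz big1 ?oppr0 // => i _; rewrite ui scale0r.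
  apply/rowP => j; rewrite mxE.
  case: (splitP (j : 'I_(3 + k))) => [i ji|i ji]; last first.
    by have -> : j = rshift 3 i; [apply: val_inj | apply: ui].
  case: i ji => [[|[|[|//]]] im] /= ji.
  - by rewrite -u00; congr (u 0 _); apply: val_inj; rewrite /= inordK.
  - by rewrite -u1; congr (u 0 _); apply: val_inj; rewrite /= inordK.
  by rewrite -u2; congr (u 0 _); apply: val_inj; rewrite /= inordK.
have surj x : exists u, phi u = x.
  have [a xp] := L2 x p; have [b xq] := L2 x q.
  (* With [[x,p] = a z] and [[x,q] = b z], this correction of [x] commutes with [p] and [q]. *)
  have [|c [e ce]] := gw (x - b *: p + a *: q).
    split; rewrite !(lbrDl, lbrNl, lbrZl) !lbr_alt ?xp ?xq ?(lbrC q p) -/z.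
      by rewrite scaler0 subr0 scalerN subrr.
    by rewrite scaler0 addr0 subrr.
  exists (\row_j match split (j : 'I_(3 + k)) with
           inl i => [:: b; - a; e]`_i | inr i => c i end); rewrite /phi !mxE.
  have S (i : 'I_3) : split (lshift k i) = inl i by apply: (unsplitK (inl i)).
  have -> : inord 0 = lshift k (inord 0 : 'I_3) by apply: val_inj; rewrite /= !inordK.
  have -> : inord 1 = lshift k (inord 1 : 'I_3) by apply: val_inj; rewrite /= !inordK.
  have -> : inord 2 = lshift k (inord 2 : 'I_3) by apply: val_inj; rewrite /= !inordK.
  rewrite !S !inordK //=; under eq_bigr do rewrite mxE (unsplitK (inr _)).
  move/eqP: ce; rewrite subr_eq => /eqP ce.
  rewrite -addrA -ce scaleNr (_ : x - b *: p + a *: q = x - (b *: p - a *: q)).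
    by rewrite addrC subrK.
  by rewrite opprB [a *: q - _]addrC addrA.
have -> : (n - 3)%N = k; last exact: (lie_iso_rV hphi inj surj).
have sk : sdim (@allv K L) k.+3 by apply: (sdim_rV lin inj surj).
by rewrite (qdim_unique (@subspace_eq0 _ L) sn sk) !subSS subn0.
Qed.

End Isomorphism.

(** * Transfer between [L] and the algebra that presents it *)

Section Presentation.
Variables (K : fieldType) (F L : lieAlgType K) (pi : F -> L).
Hypotheses (hpi : lie_hom pi) (surj : forall y, exists x, pi x = y).

Lemma lie_pow_lift k y : lie_pow L k y -> exists2 x, lie_pow F k x & pi x = y.
Proof.
elim: k y => [|[|k] IH] y.
- by have [x <-] := surj y; exists x.
- by have [x <-] := surj y; exists x.
move: y; apply: lbrs_min.
  have [F0 FD] := lie_pow_subspace F k.+2.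
  split; first by exists 0 => //; apply: lie_hom0.
  move=> a _ _ [x Fx <-] [y Fy <-]; exists (a *: x + y); first exact: FD.
  by rewrite hpi.1.
move=> _ y /IH[x Fx <-] _; have [w <-] := surj y.
by exists (lbr x w); [apply: lie_powS | rewrite hpi.2].
Qed.

Lemma fgens_lift d (w : 'I_d -> L) (f : 'I_d -> F) :
  (forall x, span_mod (lie_pow L 2) w x) -> (forall j, pi (f j) = w j) ->
  forall x, fgens (ker_of pi) f x.
Proof.
move=> gw pif x; have [c /lie_pow_lift[y Fy piy]] := gw (pi x).
have sG := @lspan_subspace _ F (fun x => [\/ exists i, x = f i, lie_pow F 2 x | ker_of pi x]).
have -> : x = (\sum_j c j *: f j) + (y + (x - (\sum_j c j *: f j) - y)).
  by rewrite [y + _]addrC subrK addrC subrK.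
apply: subspaceD => //; last apply: subspaceD => //.
- apply: subspace_sum => // j _; apply: subspaceZ => //.
  by apply: mem_lspan; constructor 1; exists j.
- by apply: mem_lspan; constructor 2.
apply: mem_lspan; constructor 3; rewrite /ker_of !lie_homB // piy (lie_hom_sum _ hpi).
rewrite (eq_bigr (fun j => c j *: w j)) ?subrr // => j _.
by rewrite lie_homZ // pif.
Qed.

Lemma span_pow2_lift m : sdim (lie_pow L 2) m ->
  exists v : 'I_m -> F, forall x, lie_pow F 2 x -> span_mod (ker_of pi) v x.
Proof.
move=> [y [_ [_ gy]]].
have [v piv] := fin_all_exists (fun j => surj (y j)).
exists v => x /(lie_hom_pow hpi)/gy[c ce]; exists c.
rewrite /ker_of lie_homB // (lie_hom_sum _ hpi) -[RHS]ce; congr (_ - _).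
by apply: eq_bigr => j _; rewrite lie_homZ // piv.
Qed.

(* For [dim L^2 = 1] either the basic commutators alone span [F^3], which makes the
   general bound drop by 3, or [L] is [H(1) + A(n-3)]. *)
Lemma span_or_HA n d (f : 'I_d -> F) (v : 'I_1 -> F) c : sdim (@allv K L) n ->
  (forall x, lie_pow L c x -> x = 0) ->
  (forall x, fgens (ker_of pi) f x) ->
  (forall x, lie_pow F 2 x -> span_mod (ker_of pi) v x) ->
  (exists w : basic d -> F, forall x, lie_pow F 3 x -> span_mod (mult2_den pi) w x) \/
  lie_isomorphic L (HA K (n - 3)).
Proof.
move=> sn Lc gf gv; have idR := ker_ideal hpi.
case: (classic (forall x, lie_pow F 2 x -> ker_of pi x)) => [R2|nR2].
  by left; eexists => x; apply: pow2_sub_pow3_span.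
have Rc x : lie_pow F c x -> ker_of pi x by move=> /(lie_hom_pow hpi)/Lc.
have [z [z2 nRz zR]] := central_ex idR Rc nR2.
have [w gw] := span_mod_exchange idR.1 gv z2 nRz.
have L2z x : lie_pow F 2 x -> addR (ker_of pi) z x.
  by move=> /gw[? [a]]; rewrite big_ord0 subr0 => Ra; exists a.
have [p [q [npq pqR {}L2z]]] := bracket_pair_ex idR nRz z2 zR L2z.
(* Such a pair puts the three extra commutators into [den] by [z_den]; without one, the centralizer
   of [p] and [q] is abelian modulo [R] and [lie_iso_HA] applies. *)
case: (classic (exists x y, [/\ ker_of pi (lbr x p), ker_of pi (lbr x q),
    ker_of pi (lbr y p), ker_of pi (lbr y q) & ~ ker_of pi (lbr x y)])) => [|nxy].
  case=> x [y [xp xq yp yq nxy]]; left.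
  have sD := den_subspace (ker_of pi); have sU := span_mod_subspace (basic_comm f) sD.
  exists (basic_comm f); apply: (pow3_span idR sU _ (lie_pow2 p q) L2z gf).
  - by move=> t; apply: span_mod_sub.
  - by move=> t; apply: span_mod_mem.
  - by move=> t u; apply: span_mod_sub; apply: (z_den idR L2z xp xq yp yq nxy).
right; apply: (lie_iso_HA (p := pi p) (q := pi q) sn); rewrite -?hpi.2 //.
- by move=> y; have [x <-] := surj y; rewrite -hpi.2; apply: pqR.
- move=> x y; have [x' <-] := surj x; have [y' <-] := surj y.
  have [a] := L2z _ (lie_pow2 x' y'); rewrite /ker_of lie_homB // lie_homZ // => /eqP.
  by rewrite subr_eq0 hpi.2 => /eqP ->; exists a.
move=> x y; have [x' <-] := surj x; have [y' <-] := surj y; rewrite -!hpi.2.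
by move=> xp xq yp yq; apply: NNPP => nxy'; apply: nxy; exists x', y'.
Qed.

End Presentation.

(** * Dimension counts for [L], and the lower bound carried along an isomorphism *)

Section Dimensions.
Variables (K : fieldType) (L : lieAlgType K).

Lemma sdim_abelianization n m : sdim (@allv K L) n -> sdim (lie_pow L 2) m ->
  exists2 d, qdim (@allv K L) (lie_pow L 2) d & n = (d + m)%N.
Proof.
move=> sn sm; have sL2 := lie_pow_subspace L 2; have s0 := @subspace_eq0 _ L.
have [d qd] : exists d, qdim (@allv K L) (lie_pow L 2) d.
  have [b [_ [_ gb]]] := sn; apply: (qdim_ex (v := b) sL2) => x _.
  by have [c e] := gb x I; exists c; rewrite e; apply: subspace0.
exists d => //; apply: (qdim_unique s0 sn); apply: (qdim_add _ sL2 s0 _ _ qd sm) => //.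
by move=> _ ->; apply: subspace0.
Qed.

(** If [L = L^2], every [L^k] is [L], so nilpotency forces [L = 0], against [m > 0]. *)
Lemma nilpotent_not_perfect m : nilpotent L -> sdim (lie_pow L 2) m -> (0 < m)%N ->
  ~ qdim (@allv K L) (lie_pow L 2) 0.
Proof.
move=> [c Lc] [y [_ [iy _]]] m0 [v [_ [_ gv]]].
have L2 x : lie_pow L 2 x by have [c'] := gv x I; rewrite big_ord0 subr0.
have Lk k : forall x, lie_pow L k x.
  elim: k => [//|[//|k] IH] x; apply: lbrs_min (L2 x); first exact: lie_pow_subspace.
  by move=> a b _ _; apply: lie_powS.
have /(iy (fun _ => 1))/(_ (Ordinal m0))/eqP : \sum_(i < m) 1 *: y i = 0 by apply: (Lc).
by rewrite oner_eq0.
Qed.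

(** Composing [pi] with the isomorphism leaves its kernel unchanged, and [F^3] lies in that kernel
    since [H(1) + A(k)] has class two; thus [hfam] is an independent family in the numerator. *)
Lemma HA_mult2_ge k (X : Type) (F : lieAlgType K) (iX : X -> F) (pi : F -> L) D :
  free_on iX -> lie_hom pi -> (forall y, exists x, pi x = y) ->
  lie_isomorphic L (HA K k) -> qdim (mult2_num pi) (mult2_den pi) D ->
  (#|{: basic k.+2}| + 3 <= D)%N.
Proof.
move=> fr hpi surj [h [hh bh]] qD.
pose pi' := h \o pi.
have hpi' : lie_hom pi' by apply: lie_hom_comp.
have kerE x : ker_of pi x -> ker_of pi' x.
  by rewrite /ker_of /pi' /= => ->; apply: lie_hom0.
have ker'E x : ker_of pi' x -> ker_of pi x.
  by rewrite /ker_of /pi' /= => e; apply: (bij_inj bh); rewrite e lie_hom0.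
have ex (j : 'I_k.+2) : exists x, pi' x = delta_mx 0 (hgen j).
  have [h' _ hK] := bh.
  by have [x ex] := surj (h' (delta_mx 0 (hgen j))); exists x; rewrite /pi' /= ex hK.
have [f pif] := fin_all_exists ex.
have denE x : mult2_den pi x -> mult2_den pi' x.
  apply: lbrs_min; first exact: lbrs_subspace.
  move=> {}x y xR _; apply: mem_lbrs => //; move: x xR.
  apply: lbrs_min; first exact: lbrs_subspace.
  by move=> x w Rx _; apply: mem_lbrs => //; apply: kerE.
have := qdim_ge (v := hfam f) (lbrs_subspace _ _) qD.
rewrite card_sum card_ord; apply.
  move=> s; split; last exact: hfam_pow3.
  by apply: ker'E; apply: HA_pow3; apply: lie_hom_pow => //; apply: hfam_pow3.
by move=> a /denE; apply: (hfam_indep fr hpi' pif).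
Qed.

(** Applied with [k = n - 3], this gives [n >= 3], so that the truncated subtraction is a genuine
    one. *)
Lemma HA_sdim k n : lie_isomorphic L (HA K k) -> sdim (@allv K L) n -> n = k.+3.
Proof.
move=> [h [hh [h' hK h'K]]] sn; apply: (qdim_unique (@subspace_eq0 _ L) sn).
have lin a u v : h' (a *: u + v) = a *: h' u + h' v.
  by apply: (can_inj hK); rewrite hh.1 !h'K.
apply: (sdim_rV lin) => [u u0|x]; last by exists (h x).
by rewrite -(h'K u) u0 lie_hom0.
Qed.

End Dimensions.

Theorem theorem2p14 (K : fieldType) (L : lieAlgType K) (n m : nat) :
  sdim (@allv K L) n ->
  sdim (lie_pow L 2) m ->
  (1 <= m)%N ->
  nilpotent L ->
  forall (X : Type) (F : lieAlgType K) (iX : X -> F) (pi : F -> L),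
    free_on iX -> lie_hom pi -> (forall y : L, exists x : F, pi x = y) ->
    exists d : nat,
      [/\ qdim (mult2_num pi) (mult2_den pi) d,
          (d%:R : rat) <= 3^-1 * ((n%:R - m%:R) *
                 ((n%:R + 2 * m%:R - 2) * (n%:R - m%:R - 1) + 3 * (m%:R - 1))) + 3,
          (d%:R : rat) <= 3^-1 * (n%:R * (n%:R - 1) * (n%:R - 2)) + 3
        & (d%:R : rat) = 3^-1 * (n%:R * (n%:R - 1) * (n%:R - 2)) + 3 <->
          lie_isomorphic L (HA K (n - 3))].
Proof.
move=> sn sm m0 nil X F iX pi fr hpi surj.
have idR := ker_ideal hpi; have sD := den_subspace (ker_of pi).
have [d qd nE] := sdim_abelianization sn sm.
have d0 : (0 < d)%N.
  by case: d qd {nE} => // /(nilpotent_not_perfect nil sm m0).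
have [w [_ [_ gw]]] := qd.
have [f pif] := fin_all_exists (fun j => surj (w j)).
have gf := fgens_lift hpi surj (fun x => gw x I) pif.
have [v gv] := span_pow2_lift hpi surj sm.
have [c Lc] := nil.
have Rc x : lie_pow F c x -> ker_of pi x by move=> /(lie_hom_pow hpi)/Lc.
(* From here [m] is one less than the dimension of [L^2], matching the family over ['I_m.+1] in
   [mult2_span]. *)
case: m m0 sm nE v gv => // m _ sm nE v gv.
have [I [u [cI gu]]] := mult2_span idR Rc gf gv.
have numD x : mult2_num pi x -> span_mod (mult2_den pi) u x by case=> Rx; apply: gu.
have [D qD] := qdim_ex sD numD.
have leD : (D <= #|{: basic d}| + 3 + d ^ 2 * m)%N by apply: leq_trans cI; apply: qdim_le qD numD.
have cb := card_basic d.
pose b := #|{: basic d}|; rewrite -/b in leD cb.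
have leDQ : D%:R <= b%:R + 3 + d%:R ^+ 2 * m%:R :> rat.
  by rewrite -natrX -natrM -[3]/(3%:R) -!natrD ler_nat.
have cbQ : 3 * b%:R + d%:R = d%:R ^+ 3 :> rat.
  by rewrite -natrX -cb natrD natrM.
have nQ : n%:R = d%:R + m%:R + 1 :> rat by rewrite nE addnS -natr1 natrD.
have mQ : m.+1%:R = m%:R + 1 :> rat by rewrite -natr1.
have d1 : 1 <= d%:R :> rat by rewrite ler1n.
(* The right-hand side is exactly [b + 3 + d^2 m]. *)
have bound1 : D%:R <= 3^-1 * ((n%:R - m.+1%:R) * ((n%:R + 2 * m.+1%:R - 2) *
    (n%:R - m.+1%:R - 1) + 3 * (m.+1%:R - 1))) + 3 :> rat.
  by rewrite mQ nQ; nra.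
(* the two bounds differ by [d m^2 + (m^3 - m) / 3], with [m] here one less than [dim L^2] *)
have gap : 3^-1 * (n%:R * (n%:R - 1) * (n%:R - 2)) + 3 =
    b%:R + 3 + d%:R ^+ 2 * m%:R + (d%:R * m%:R ^+ 2 + 3^-1 * (m%:R ^+ 3 - m%:R)) :> rat.
  have -> : b%:R = 3^-1 * (d%:R ^+ 3 - d%:R) :> rat by lra.
  by rewrite nQ; field.
have m3 : 0 <= m%:R ^+ 3 - m%:R :> rat.
  by rewrite -natrX subr_ge0 ler_nat -{1}(expn1 m); case: (m) => // k; rewrite leq_pexp2l.
have dm : 0 <= d%:R * m%:R ^+ 2 :> rat by rewrite -natrX -natrM ler0n.
exists D; split=> //; first by rewrite gap; lra.
split=> [DE|iso].
  (* Equality forces both nonnegative terms of [gap] to vanish; as [d > 0], this leaves [m = 0]. *)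
  have dm0 : d%:R * m%:R ^+ 2 = 0 :> rat by lra.
  have m00 : m = 0%N.
    by move/eqP: dm0; rewrite -natrX -natrM pnatr_eq0 muln_eq0 expn_eq0 andbT;
      case: (d) d0 => //= k _ /eqP.
  (* If the basic commutators alone span, then [D <= b], whereas [DE] reads [D = b + 3]. *)
  subst m; case: (span_or_HA hpi surj sn Lc gf gv) => // -[b' gb'].
  have : (D <= b)%N by apply: (qdim_le sD qD (v := b')) => x [_]; apply: gb'.
  rewrite -(ler_nat rat); move: DE; rewrite gap; nra.
have n3 := HA_sdim iso sn.
have := HA_mult2_ge fr hpi surj iso qD.
have cb' := card_basic (n - 3).+2; move: cb'; set b' := #|_| => cb' geD.
have geDQ : b'%:R + 3 <= D%:R :> rat by rewrite -[3]/(3%:R) -natrD ler_nat.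
(* The lower bound counts basic commutators in [n - 1] generators, and
   [((n-1)^3 - (n-1))/3 = n(n-1)(n-2)/3]. *)
have e1 : n%:R = (n - 3).+2%:R + 1 :> rat by rewrite {1}n3 -natr1.
have cbQ' : 3 * b'%:R + (n - 3).+2%:R = (n - 3).+2%:R ^+ 3 :> rat.
  by rewrite -natrX -cb' natrD natrM.
apply/eqP; rewrite eq_le; apply/andP; split; first by rewrite gap; lra.
have bE : b'%:R = 3^-1 * ((n - 3).+2%:R ^+ 3 - (n - 3).+2%:R) :> rat by lra.
apply: le_trans geDQ; rewrite bE e1 le_eqVlt; apply/orP; left; by apply/eqP; field.
Qed.
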